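(* Let $\Bbbk$ be an algebraically closed field of characteristic $0$. Consider a crossed product $T = A*G$, where $A$ is a prime noetherian $\Bbbk$-algebra and $G$ is a finite group. Suppose that the action of $G$ on $A$ is $X$-outer, and that $G$ acts as a group of $\Bbbk$-linear automorphisms on the centre $Z(A)$. Then $T$ is prime noetherian. Moreover, $T$ is Azumaya if and only if (1) $A$ is Azumaya; and (2) $G$ acts freely on $Z(A)$; that is, the stabiliser of every maximal ideal of $Z(A)$ is trivial. If $T$ is Azumaya, then the rank of $T$ over its centre satisfies $\operatorname{rank} T = |G|^2 \operatorname{rank} A$.
   Context: Noetherian means left and right noetherian. Crossed product: for a ring $A$ and a group $G$, a crossed product $A*G$ is a ring containing a copy of $A$ and a set of units $\overline{G} = \{\overline{g} \mid g \in G\}$ in bijection with $G$ such that (1) $A*G$ is a free left $A$-module with basis $\overline{G}$, and $\overline{e}=1$; (2) $\overline{g}A = A\overline{g}$ for all $g\in G$; (3) $A\overline{g}\,\overline{h} = A\overline{gh}$ for all $g,h \in G$. Each $\overline{g}$ induces an automorphism $\alpha_g$ of $A$ via $\overline{g}a = \alpha_g(a)\overline{g}$. One says that $G$ acts on $A$ via the $\alpha_g$, although in general $\{\alpha_g \mid g \in G\}$ need not be a group; the hypothesis on $Z(A)$ says that the restrictions of the $\alpha_g$ to $Z(A)$ do give a group action by $\Bbbk$-linear automorphisms. Symmetric Martindale ring of quotients: for a prime ring $R$, $Q_s(R)$ is the ring extension of $R$ uniquely determined by: (1) if $q \in Q_s(R)$ then there exist nonzero ideals $I,J$ of $R$ with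 $Iq, qJ \subseteq R$; (2) if $q \in Q_s(R)$ and $I$ is a nonzero ideal of $R$ with $Iq=0$ or $qI=0$, then $q=0$; (3) if $I,J$ are nonzero ideals of $R$ and $f: {}_RI \to {}_RR$, $g: J_R \to R_R$ are module homomorphisms with $f(a)b = a g(b)$ for all $a\in I$, $b \in J$, then there is $q \in Q_s(R)$ with $f(a)=aq$ and $g(b)=qb$ for all $a\in I$, $b\in J$. An automorphism of a prime ring $R$ is $X$-inner if it equals conjugation by an element of $Q_s(R)$, and $X$-outer otherwise. The action of $G$ on $A$ is $X$-outer if only the identity element of $G$ acts as an $X$-inner automorphism. Azumaya: a ring $A$ with centre $Z$ is Azumaya (over its centre) if $A$ is a finitely generated projective $Z$-module and the map $A\otimes_Z A^{\mathrm{op}} \to \operatorname{End}_Z(A)$, $a\otimes b \mapsto (r\mapsto arb)$, is an isomorphism. If $A$ is prime Azumaya, then $\dim_{Z/\mathfrak{m}}(A/\mathfrak{m}A)$ is the same for all maximal ideals $\mathfrak{m}$ of $Z$; this value is the rank of $A$ over its centre.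
   Formalization: ''T Azumaya implies G acts freely on Z(A)'' is proved only when every maximal ideal of Z(A) has residue field k; without this it fails, e.g. A = k(t), G = Z/2 acting by t -> -t, where T = M_2(k(t^2)) is Azumaya but the maximal ideal 0 is stabilised by G. *)

(* Defs.v *)
From HB Require Import structures.
From mathcomp Require Import all_fingroup all_boot all_algebra.
From mathcomp Require Import boolp classical_sets.
From mathcomp Require Import generic_quotient freeg.

Set Implicit Arguments.
Unset Strict Implicit.
Unset Printing Implicit Defensive.

Import GRing.Theory.

Local Open Scope classical_set_scope.
Local Open Scope ring_scope.

Section Ideals.
Variable R : nzRingType.
Implicit Types I J : set R.

Definition left_ideal I :=
  [/\ I 0, forall a b, I a -> I b -> I (a + b) & forall r a, I a -> I (r * a)].

Definition right_ideal I :=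
  [/\ I 0, forall a b, I a -> I b -> I (a + b) & forall r a, I a -> I (a * r)].

Definition ideal I := left_ideal I /\ right_ideal I.

Definition nonzero_ideal I := ideal I /\ exists2 a, I a & a != 0.

Definition maximal_ideal I :=
  [/\ ideal I, ~ I 1
    & forall J, ideal J -> ~ J 1 -> I `<=` J -> J = I].

Definition prime_ring :=
  forall I J, ideal I -> ideal J -> (forall a b, I a -> J b -> a * b = 0) ->
    I = [set 0] \/ J = [set 0].

Definition acc (P : set R -> Prop) :=
  forall I : nat -> set R,
    (forall n, P (I n)) -> (forall n, I n `<=` I n.+1) ->
    exists N, forall n, (N <= n)%N -> I n = I N.

Definition noetherian := acc left_ideal /\ acc right_ideal.

End Ideals.

Arguments prime_ring : clear implicits.
Arguments noetherian : clear implicits.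

Section Unit.
Variable R : nzRingType.

(* [GRing.unit] is only available on rings equipped with a chosen inverse. *)
Definition is_unit (u : R) := exists v, v * u = 1 /\ u * v = 1.

End Unit.

(* The centre, as a commutative ring, and the ring as a module over it. *)
Section Centre.
Variable R : nzRingType.

Definition central : {pred R} := [pred z | `[< forall a, z * a = a * z >]].

Lemma centralP z : reflect (forall a, z * a = a * z) (z \in central).
Proof. exact: asboolP. Qed.

Fact central_subring : subring_closed central.
Proof.
split=> [|x y /centralP hx /centralP hy|x y /centralP hx /centralP hy].
- by apply/centralP => a; rewrite mul1r mulr1.
- by apply/centralP => a; rewrite mulrBl mulrBr hx hy.
- by apply/centralP => a; rewrite -mulrA hy mulrA hx mulrA.
Qed.

HB.instance Definition _ :=
  GRing.isSubringClosed.Build R central central_subring.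

Record centre := Centre { centre_val :> R; _ : centre_val \in central }.

HB.instance Definition _ := [isSub for centre_val].
HB.instance Definition _ := [Choice of centre by <:].
HB.instance Definition _ := [SubChoice_isSubNzRing of centre by <:].

Lemma centreC (z : centre) (a : R) : centre_val z * a = a * centre_val z.
Proof. by case: z => z /= /centralP. Qed.

Fact centre_mulrC : commutative (@GRing.mul centre).
Proof. by move=> z w; apply: val_inj; rewrite !rmorphM /= centreC. Qed.

HB.instance Definition _ :=
  GRing.PzRing_hasCommutativeMul.Build centre centre_mulrC.

Definition over_centre : Type := R.

HB.instance Definition _ := GRing.Zmodule.on over_centre.

Definition centre_scale (z : centre) (x : over_centre) : over_centre :=
  centre_val z * (x : R).

Fact centre_scaleA z w x :
  centre_scale z (centre_scale w x) = centre_scale (z * w) x.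
Proof. by rewrite /centre_scale mulrA. Qed.
Fact centre_scale1 : left_id 1 centre_scale.
Proof. by move=> x; rewrite /centre_scale mul1r. Qed.
Fact centre_scaleDr : right_distributive centre_scale +%R.
Proof. by move=> z x y; rewrite /centre_scale mulrDr. Qed.
Fact centre_scaleDl x : {morph centre_scale^~ x : z w / z + w}.
Proof. by move=> z w; rewrite /centre_scale mulrDl. Qed.

HB.instance Definition _ := GRing.Zmodule_isLmodule.Build centre over_centre
  centre_scaleA centre_scale1 centre_scaleDr centre_scaleDl.

Lemma centre_scaleE (z : centre) (x : over_centre) :
  z *: x = centre_val z * (x : R) :> R.
Proof. by []. Qed.

End Centre.

Section Modules.
Variables (Z : comNzRingType) (M : lmodType Z).

Definition finitely_generated :=
  exists (n : nat) (e : 'I_n -> M),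
    forall x, exists c : 'I_n -> Z, x = \sum_i c i *: e i.

Definition projective :=
  forall (N P : lmodType Z) (p : {linear N -> P}) (f : {linear M -> P}),
    (forall y, exists x, p x = y) ->
    exists h : {linear M -> N}, forall x, p (h x) = f x.

(* The submodule I M, for I an ideal of Z. *)
Definition ideal_submod (I : set Z) : set M :=
  [set x | exists (n : nat) (z : 'I_n -> Z) (a : 'I_n -> M),
    (forall i, I (z i)) /\ x = \sum_i z i *: a i].

(* M / m M has dimension n over Z / m: the classes of some e_0, ..., e_(n-1)
   form a basis. *)
Definition fibre_dim (m : set Z) (n : nat) :=
  exists e : 'I_n -> M,
    (forall x, exists c : 'I_n -> Z, ideal_submod m (x - \sum_i c i *: e i)) /\
    (forall c : 'I_n -> Z,
      ideal_submod m (\sum_i c i *: e i) -> forall i, m (c i)).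

End Modules.

Arguments finitely_generated {Z} M.
Arguments projective {Z} M.

(* M (x)_Z N: the free abelian group on M * N modulo the bilinearity and
   balancing relations. *)
Section Tensor.
Variables (Z : comNzRingType) (M N : lmodType Z).
Local Notation F := {freeg (M * N)%type}.

Local Notation gen x y := (<< 1 *g (x, y) >> : F).

Inductive tensor_relator : F -> Prop :=
| TensorDl x x' y : tensor_relator (gen (x + x') y - gen x y - gen x' y)
| TensorDr x y y' : tensor_relator (gen x (y + y') - gen x y - gen x y')
| TensorZ (z : Z) x y : tensor_relator (gen (z *: x) y - gen x (z *: y)).

Definition tensor_null : {pred F} :=
  [pred u | `[< forall S : {pred F}, zmod_closed S ->
                  (forall v, tensor_relator v -> v \in S) -> u \in S >]].

Fact tensor_null_zmod : zmod_closed tensor_null.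
Proof.
split=> [|u v /asboolP hu /asboolP hv].
  by apply/asboolP => S [].
by apply/asboolP => S cS hS; apply: cS.2; [exact: hu|exact: hv].
Qed.

HB.instance Definition _ := GRing.isZmodClosed.Build F tensor_null
  tensor_null_zmod.

Definition tensor := Quotient.quot (tensor_null : zmodClosed F).
HB.instance Definition _ := GRing.Zmodule.on tensor.

Definition tens (x : M) (y : N) : tensor := \pi_(tensor)%qT (gen x y).

End Tensor.

Arguments tensor {Z} M N.
Arguments tens {Z M N} x y.

(* The map A (x)_Z A^op -> End_Z(A), a (x) b |-> (r |-> a r b), for Z the centre
   of A. Since A^op and A are the same Z-module, the source is built as
   A (x)_Z A. *)
Section Sandwich.
Variable R : nzRingType.
Local Notation RZ := (over_centre R).
Local Notation F := {freeg (RZ * RZ)%type}.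

Definition sandwich_free (r : R) (u : F) : R :=
  fglift (fun p => (p.1 : R) * r * (p.2 : R) : zmodule R) u.

Lemma sandwich_freeE r u :
  sandwich_free r u =
    \sum_(x <- repr u) (x.2.1 : R) * r * (x.2.2 : R) *~ x.1.
Proof. by rewrite /sandwich_free -{1}[u]freeg_repr fglift_Freeg. Qed.

Lemma sandwich_freeB r u v :
  sandwich_free r (u - v) = sandwich_free r u - sandwich_free r v.
Proof. exact: (@lift_is_additive int _ (zmodule R) _ u v). Qed.

Lemma sandwich_freeU r x y :
  sandwich_free r << 1 *g (x, y) >> = (x : R) * r * (y : R).
Proof. by rewrite /sandwich_free liftU scale1r. Qed.

Lemma sandwich_null r u : u \in @tensor_null _ RZ RZ -> sandwich_free r u = 0.
Proof.
move=> /asboolP /(_ [pred v | sandwich_free r v == 0]) h.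
apply/eqP; apply: h.
  have s0 : sandwich_free r 0 = 0.
    by rewrite -[X in sandwich_free r X](subrr 0) sandwich_freeB subrr.
  split; first by rewrite inE s0.
  by move=> a b; rewrite !inE sandwich_freeB => /eqP-> /eqP->; rewrite subrr.
move=> v hv; rewrite inE; case: hv => [x x' y|x y y'|z x y];
  rewrite !sandwich_freeB !sandwich_freeU.
- by rewrite !mulrDl addrAC addrK subrr.
- by rewrite mulrDr addrAC addrK subrr.
- rewrite !centre_scaleE (centreC z (y : R)) -!mulrA (centreC z) -!mulrA.
  by rewrite subrr.
Qed.

Definition sandwich_fun (t : tensor RZ RZ) (r : RZ) : RZ :=
  sandwich_free r (repr t).

Fact sandwich_fun_linear t : linear (sandwich_fun t).
Proof.
move=> z r s; rewrite /sandwich_fun !sandwich_freeE scaler_sumr -big_split.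
apply: eq_bigr => x _ /=; rewrite centre_scaleE mulrDr mulrDl mulrzDl.
congr (_ + _); rewrite centre_scaleE mulrzAr; congr (_ *~ _).
by rewrite !mulrA centreC.
Qed.

HB.instance Definition _ t :=
  GRing.isLinear.Build (centre R) RZ RZ _ (sandwich_fun t)
    (sandwich_fun_linear t).

Definition sandwich (t : tensor RZ RZ) : {linear RZ -> RZ} := sandwich_fun t.

Lemma sandwich_pi (u : F) (r : RZ) :
  sandwich (\pi_(tensor RZ RZ)%qT u) r = sandwich_free r u.
Proof.
apply/eqP; rewrite -subr_eq0 -sandwich_freeB sandwich_null //.
by rewrite Quotient.idealrBE reprK.
Qed.

Lemma sandwichB t u r : sandwich (t - u) r = sandwich t r - sandwich u r.
Proof.
elim/quotW: t => t; elim/quotW: u => u.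
by rewrite -[X in sandwich X]raddfB !sandwich_pi sandwich_freeB.
Qed.

Lemma sandwich_tens (a b : RZ) (r : RZ) :
  sandwich (tens a b) r = (a : R) * (r : R) * (b : R).
Proof. by rewrite sandwich_pi sandwich_freeU. Qed.

End Sandwich.

Definition azumaya (R : nzRingType) :=
  [/\ finitely_generated (over_centre R), projective (over_centre R)
    & bijective (@sandwich R)].

(* For R prime Azumaya there is exactly one such n, the rank of R. *)
Definition has_rank (R : nzRingType) (n : nat) :=
  forall m : set (centre R), maximal_ideal m ->
    @fibre_dim (centre R) (over_centre R) m n.

(* The symmetric Martindale ring of quotients Q of R, with the inclusion j. *)
Definition symmetric_martindale (R Q : nzRingType) (j : {rmorphism R -> Q}) :=
  [/\ injective j,
      forall q, exists I J : set R,
        [/\ nonzero_ideal I, nonzero_ideal J,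
            forall a, I a -> exists r, j a * q = j r
          & forall b, J b -> exists r, q * j b = j r],
      forall q (I : set R), nonzero_ideal I ->
        (forall a, I a -> j a * q = 0) \/ (forall a, I a -> q * j a = 0) ->
        q = 0
    & forall (I J : set R) (f g : R -> R),
        nonzero_ideal I -> nonzero_ideal J ->
        (forall a b, I a -> I b -> f (a + b) = f a + f b) ->
        (forall r a, I a -> f (r * a) = r * f a) ->
        (forall a b, J a -> J b -> g (a + b) = g a + g b) ->
        (forall r a, J a -> g (a * r) = g a * r) ->
        (forall a b, I a -> J b -> f a * b = a * g b) ->
        exists q, (forall a, I a -> j (f a) = j a * q) /\
                  (forall b, J b -> j (g b) = q * j b)].

Definition x_inner (R Q : nzRingType) (j : {rmorphism R -> Q})
    (sigma : R -> R) :=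
  exists u v : Q, [/\ u * v = 1, v * u = 1
                    & forall a, j (sigma a) = u * j a * v].

Record crossed_product (A : nzRingType) (G : finGroupType) (T : nzRingType) :=
  CrossedProduct {
    cp_in : {rmorphism A -> T};
    cp_bar : G -> T;
    cp_in_inj : injective cp_in;
    cp_bar_inj : injective cp_bar;
    cp_bar_unit : forall g, is_unit (cp_bar g);
    cp_basis : forall t, exists! c : {ffun G -> A},
      t = \sum_(g : G) cp_in (c g) * cp_bar g;
    cp_bar1 : cp_bar 1%g = 1;
    cp_norm : forall g, range (fun a => cp_bar g * cp_in a)
                      = range (fun a => cp_in a * cp_bar g);
    cp_mul : forall g h, range (fun a => cp_in a * (cp_bar g * cp_bar h))
                       = range (fun a => cp_in a * cp_bar (g * h)%g) }.

Section CrossedProduct.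
Variables (A : nzRingType) (G : finGroupType) (T : nzRingType).
Variable X : crossed_product A G T.

Fact cp_act_subproof g a :
  exists b, cp_bar X g * cp_in X a = cp_in X b * cp_bar X g.
Proof.
have : range (fun a => cp_bar X g * cp_in X a) (cp_bar X g * cp_in X a).
  by exists a.
by rewrite cp_norm => -[b _ <-]; exists b.
Qed.

(* The automorphism alpha_g, characterised by cp_actE. *)
Definition cp_act (g : G) (a : A) : A := sval (cid (cp_act_subproof g a)).

Lemma cp_actE g a : cp_bar X g * cp_in X a = cp_in X (cp_act g a) * cp_bar X g.
Proof. exact: svalP (cid (cp_act_subproof g a)). Qed.

Lemma cp_act_uniq g a b :
  cp_bar X g * cp_in X a = cp_in X b * cp_bar X g -> cp_act g a = b.
Proof.
rewrite cp_actE => h; have [v [_ uv]] := cp_bar_unit X g.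
by apply: (@cp_in_inj _ _ _ X); rewrite -[LHS]mulr1 -uv mulrA h -mulrA uv mulr1.
Qed.

Lemma cp_act_surj g b : exists a, cp_act g a = b.
Proof.
have : range (fun a => cp_in X a * cp_bar X g) (cp_in X b * cp_bar X g).
  by exists b.
by rewrite -cp_norm => -[a _ /cp_act_uniq]; exists a.
Qed.

Lemma cp_actM g a b : cp_act g (a * b) = cp_act g a * cp_act g b.
Proof.
by apply: cp_act_uniq; rewrite !rmorphM mulrA cp_actE -mulrA cp_actE mulrA.
Qed.

Fact cp_act_central g (z : centre A) : cp_act g z \in @central A.
Proof.
apply/centralP => b; have [a <-] := cp_act_surj g b.
by rewrite -!cp_actM centreC.
Qed.

Definition cp_act_centre (g : G) (z : centre A) : centre A :=
  Centre (cp_act_central g z).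

Definition stabiliser (m : set (centre A)) : set G :=
  [set g | cp_act_centre g @` m = m].

Definition acts_freely :=
  forall m : set (centre A), maximal_ideal m -> stabiliser m = [set 1%g].

Definition x_outer (Q : nzRingType) (j : {rmorphism A -> Q}) :=
  forall g, x_inner j (cp_act g) -> g = 1%g.

End CrossedProduct.

(* G acts on the centre by ring automorphisms in any case. *)
Definition acts_linearly_on_centre (k : closedFieldType) (A : algType k)
    (G : finGroupType) (T : nzRingType) (X : crossed_product A G T) :=
  [/\ forall z : centre A, cp_act_centre X 1%g z = z,
      forall g h (z : centre A),
        cp_act_centre X (g * h)%g z
          = cp_act_centre X g (cp_act_centre X h z)
    & forall g (c : k) (z : centre A),
        cp_act X g (c *: centre_val z : A) = c *: (cp_act X g (centre_val z) : A)].

(* Every maximal ideal m of the centre satisfies Z(A) = k + m, i.e. has residue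
   field k. This is automatic if Z(A) is affine over k. Without it, T can be
   Azumaya although m has a nontrivial stabiliser: for A = k(t) and G = Z/2
   acting by t |-> -t, the skew group ring T is a 2 x 2 matrix ring over
   k(t^2), while G stabilises the maximal ideal 0. *)
Definition residue_fields_trivial (k : closedFieldType) (A : algType k) :=
  forall m : set (centre A), maximal_ideal m ->
    forall z : centre A, exists (c : k) (w : centre A),
      m w /\ centre_val z = c%:A + centre_val w :> A.

(* Main.v *)
(** A ring S is Azumaya iff it has a dual basis x = sum_i f_i(x) e_i over its
    centre in which every f_i is a "sandwich" x |-> sum a x b with central
    values; injectivity of S (x) S^op -> End(S) then says that a relation
    sum u x v = 0 (x in S) forces sum b(u, v) = 0 for every balanced b.

    X-outerness forces any c in A with a c = c g(a) for all a, g <> 1, to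
    vanish; so nonzero ideals of T meet A, and Z(T) = Z(A)^G.

    Suppose T is Azumaya.  Applying balanced maps built from the coefficient
    functions of T = (+) A g to the relations defining its dual basis gives a
    dual basis of A, so A is Azumaya; by Skolem-Noether G is faithful on Z(A),
    and then the projection T -> A is a sandwich with coefficients in A.  By
    Skolem-Noether again, modulo an ideal m of Z(A) containing all z - g(z),
    with g <> 1, every coordinate of A lies in m; so does the trace
    sum f_i(e_i), which is a positive integer, hence a unit.  So these z - g(z)
    generate the unit ideal, i.e. Z(A) is Galois over Z(A)^G.

    Conversely, if A is Azumaya and Z(A) is Galois over Z(A)^G then a dual
    basis of T is written down from one of A and Galois coordinates p_k, q_k.
    Its trace is |G|^2 times that of A.  In characteristic 0 the rank at each
    maximal ideal is the trace of an idempotent matrix, so it is read off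
    there. *)
From HB Require Import structures.
Require Import Defs.
From mathcomp Require Import all_fingroup all_boot all_algebra.
From mathcomp Require Import boolp classical_sets generic_quotient freeg.
From mathcomp Require Import ring_quotient fraction.

Import GRing.Theory.
Local Open Scope ring_scope.

Set Implicit Arguments.
Unset Strict Implicit.
Unset Printing Implicit Defensive.

(** * Sandwich maps and dual bases *)

Section Sandwich.
Variable S : nzRingType.
Implicit Types (s : seq (S * S)) (f g : S -> S).

Definition sw s (x : S) := \sum_(p <- s) p.1 * x * p.2.

Definition is_sw f := exists s, forall x, f x = sw s x.

Lemma sw_cat s s' x : sw (s ++ s') x = sw s x + sw s' x.
Proof. exact: big_cat. Qed.

Lemma sw_scale s a b x : sw [seq (a * p.1, p.2 * b) | p <- s] x = a * sw s x * b.
Proof.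
rewrite /sw big_map mulr_sumr mulr_suml.
by apply: eq_bigr => p _; rewrite /= !mulrA.
Qed.

Lemma sw_mull s a x : sw [seq (a * p.1, p.2) | p <- s] x = a * sw s x.
Proof.
by rewrite /sw big_map mulr_sumr; apply: eq_bigr => p _; rewrite /= !mulrA.
Qed.

Lemma sw_mulr s a x : sw [seq (p.1, p.2 * a) | p <- s] x = sw s x * a.
Proof.
by rewrite /sw big_map mulr_suml; apply: eq_bigr => p _; rewrite /= !mulrA.
Qed.

Lemma sw_inl s a x : sw [seq (p.1 * a, p.2) | p <- s] x = sw s (a * x).
Proof. by rewrite /sw big_map; apply: eq_bigr => p _; rewrite /= !mulrA. Qed.

Lemma sw_inr s a x : sw [seq (p.1, a * p.2) | p <- s] x = sw s (x * a).
Proof. by rewrite /sw big_map; apply: eq_bigr => p _; rewrite /= !mulrA. Qed.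

Lemma sw_opp s x : sw [seq (- p.1, p.2) | p <- s] x = - sw s x.
Proof. by rewrite /sw big_map -sumrN; apply: eq_bigr => p _; rewrite /= !mulNr. Qed.

Lemma sw_flatten (I : Type) (r : seq I) (F : I -> seq (S * S)) x :
  sw (flatten [seq F i | i <- r]) x = \sum_(i <- r) sw (F i) x.
Proof. by rewrite /sw big_flatten big_map. Qed.

Lemma eq_is_sw f g : f =1 g -> is_sw f -> is_sw g.
Proof. by move=> fg [s h]; exists s => x; rewrite -fg. Qed.

Lemma is_sw_mul a b : is_sw (fun x => a * x * b).
Proof. by exists [:: (a, b)] => x; rewrite /sw big_seq1. Qed.

Lemma is_sw_sum (I : Type) (r : seq I) (F : I -> S -> S) :
  (forall i, is_sw (F i)) -> is_sw (fun x => \sum_(i <- r) F i x).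
Proof.
move=> /choice[s hs]; exists (flatten [seq s i | i <- r]) => x.
by rewrite sw_flatten; apply: eq_bigr.
Qed.

Lemma is_sw_scale a b f : is_sw f -> is_sw (fun x => a * f x * b).
Proof.
by case=> s h; exists [seq (a * p.1, p.2 * b) | p <- s] => x; rewrite sw_scale h.
Qed.

Lemma is_sw_comp f g : is_sw f -> is_sw g -> is_sw (f \o g).
Proof.
move=> [s hs] hg; apply: (@eq_is_sw (fun x => \sum_(p <- s) p.1 * g x * p.2)).
  by move=> x; rewrite /= hs.
by apply: is_sw_sum => p; apply: is_sw_scale.
Qed.

Lemma sw0 s : sw s 0 = 0.
Proof. by rewrite /sw big1 // => p _; rewrite mulr0 mul0r. Qed.

Lemma sw_linear s z x y : z \in @central S -> sw s (z * x + y) = z * sw s x + sw s y.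
Proof.
move=> /centralP hz; rewrite /sw mulr_sumr -big_split; apply: eq_bigr => p _ /=.
by rewrite mulrDr mulrDl !mulrA hz.
Qed.

Lemma is_sw_linear f z x y : is_sw f -> z \in @central S ->
  f (z * x + y) = z * f x + f y.
Proof. by case=> s h /sw_linear hz; rewrite !h hz. Qed.

Lemma is_swZ f z x : is_sw f -> z \in @central S -> f (z * x) = z * f x.
Proof. by case=> s h /(sw_linear s x 0); rewrite !addr0 sw0 addr0 -!h. Qed.

(** The coordinates take values in [S], so that being a sandwich makes sense for them; [az_coord]
    repackages them as elements of the centre. *)
Definition az_basis (I : finType) (e : I -> S) (f : I -> S -> S) :=
  [/\ forall i, is_sw (f i), forall i x, f i x \in @central S
    & forall x, x = \sum_i f i x * e i].

Definition biadditive (M : zmodType) (b : S -> S -> M) :=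
  (forall u v w, b (u + v) w = b u w + b v w) /\
  (forall u v w, b u (v + w) = b u v + b u w).

Section Balanced.
(** Balancedness is required only modulo [D]: {0} serves for exact identities, an ideal for
    congruences. *)
Variables (M : zmodType) (b : S -> S -> M) (D : set M).
Hypothesis b_add : biadditive b.
Hypotheses (D0 : D 0) (DD : forall a c, D a -> D c -> D (a + c)).

Lemma biadd0l v : b 0 v = 0.
Proof. by apply: (@addrI _ (b 0 v)); rewrite -b_add.1 !addr0. Qed.

Lemma biadd0r v : b v 0 = 0.
Proof. by apply: (@addrI _ (b v 0)); rewrite -b_add.2 !addr0. Qed.

Lemma biadd_suml (I : Type) (r : seq I) (F : I -> S) v :
  b (\sum_(i <- r) F i) v = \sum_(i <- r) b (F i) v.
Proof.
by apply: (big_morph (b^~ v)); [move=> x y; exact: b_add.1|exact: biadd0l].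
Qed.

Lemma biadd_sumr (I : Type) (r : seq I) (F : I -> S) v :
  b v (\sum_(i <- r) F i) = \sum_(i <- r) b v (F i).
Proof. by apply: (big_morph (b v)); [move=> x y; exact: b_add.2|exact: biadd0r]. Qed.

Lemma closed_sum (I : Type) (r : seq I) (F : I -> M) :
  (forall i, D (F i)) -> D (\sum_(i <- r) F i).
Proof. by move=> h; apply: big_ind. Qed.

(* The sandwich map out of S (x) S is injective: as v = sum_i f_i(v) e_i, an
   element sum u (x) v of its kernel is
   sum_i (sum u f_i(v)) (x) e_i, and sum u f_i(v) = 0 as f_i is a sandwich. *)
Lemma az_balanced (I : finType) (e : I -> S) (f : I -> S -> S) :
  az_basis e f ->
  (forall u v z, z \in @central S -> D (b u (z * v) - b (u * z) v)) ->
  forall s, (forall x, sw s x = 0) -> D (\sum_(p <- s) b p.1 p.2).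
Proof.
move=> [fsw fc fe] bal s s0.
have h0 : \sum_(p <- s) \sum_i b (p.1 * f i p.2) (e i) = 0.
  rewrite exchange_big big1 // => i _; rewrite -biadd_suml.
  suff -> : \sum_(p <- s) p.1 * f i p.2 = 0 by rewrite biadd0l.
  have [t ht] := fsw i.
  under eq_bigr => p _ do rewrite ht /sw mulr_sumr.
  rewrite exchange_big big1 // => q _.
  transitivity (sw s q.1 * q.2); last by rewrite s0 mul0r.
  by rewrite mulr_suml; apply: eq_bigr => p _; rewrite !mulrA.
suff -> : \sum_(p <- s) b p.1 p.2 =
    \sum_(p <- s) \sum_i (b p.1 (f i p.2 * e i) - b (p.1 * f i p.2) (e i)).
  by apply: closed_sum => p; apply: closed_sum => i; apply: bal.
under [RHS]eq_bigr => p _ do rewrite sumrB.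
rewrite sumrB h0 subr0; apply: eq_bigr => p _.
by rewrite [in LHS](fe p.2) biadd_sumr.
Qed.

End Balanced.

Lemma az_balanced0 (M : zmodType) (b : S -> S -> M) (I : finType) (e : I -> S)
    (f : I -> S -> S) :
  az_basis e f -> biadditive b ->
  (forall u v z, z \in @central S -> b u (z * v) = b (u * z) v) ->
  forall s, (forall x, sw s x = 0) -> \sum_(p <- s) b p.1 p.2 = 0.
Proof.
move=> ef b_add bal; apply: (@az_balanced M b (fun x => x = 0)) ef _ => //.
  by move=> x y -> ->; rewrite addr0.
by move=> u v z hz; rewrite bal // subrr.
Qed.

End Sandwich.

(** Surjectivity of [sandwich] is an equality of bundled linear maps; their class fields are
    propositions, so proof irrelevance applies. *)
Lemma eq_linear_fun (Z : nzRingType) (U V : lmodType Z) (g h : {linear U -> V}) :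
  g =1 h -> g = h.
Proof.
case: g => g cg; case: h => h ch /= /funext gh; destruct gh.
congr GRing.Linear.Pack; case: cg ch => [[a1] [a2]] [[b1] [b2]].
by rewrite (Prop_irrelevance a1 b1) (Prop_irrelevance a2 b2).
Qed.

(** * Azumaya rings as rings with a dual basis of sandwiches *)

Section AzumayaBasis.
Variable S : nzRingType.
Local Notation Z := (centre S).
Local Notation SZ := (over_centre S).

Lemma tens_biadditive : biadditive (fun u v : S => tens (u : SZ) (v : SZ)).
Proof.
have rel u v : u - v \in @tensor_null Z SZ SZ ->
    \pi_(tensor SZ SZ)%qT u = \pi_(tensor SZ SZ)%qT v.
  by rewrite Quotient.idealrBE => /eqP.
split=> u v w; rewrite /tens -raddfD; apply: rel.
  rewrite opprD addrA; apply/asboolP => T _; apply; exact: TensorDl.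
rewrite opprD addrA; apply/asboolP => T _; apply; exact: TensorDr.
Qed.

Lemma tens_balanced (u v z : S) : z \in @central S ->
  tens (u : SZ) (z * v : SZ) = tens (u * z : SZ) (v : SZ).
Proof.
move=> hz; rewrite -((centralP _ hz) u).
apply/esym/eqP; rewrite /tens -Quotient.idealrBE.
apply/asboolP => T _; apply.
exact: (TensorZ (Centre hz)).
Qed.


(** The integer coefficients of a representative are absorbed into the first factor. *)
Lemma tens_sumP (t : tensor SZ SZ) :
  exists s : seq (S * S), t = \sum_(p <- s) tens (p.1 : SZ) (p.2 : SZ).
Proof.
rewrite -[t]reprK; move: (repr t) => u; rewrite -[u]freeg_sumE raddf_sum /=.
exists [seq ((x.1 : S) *~ coeff x u, x.2 : S) | x <- dom u]; rewrite [RHS]big_map.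
apply: eq_bigr => -[x y] _ /=; set k := coeff _ _.
have -> : << k *g (x, y) >> = << 1 *g (x, y) >> *~ k :> {freeg (SZ * SZ)}.
  apply/eqP/freeg_eqP => z; rewrite raddfMz coeffU.
  by rewrite [X in _ = X *~ k]coeffU mul1r -mulrzr mulrC intz.
rewrite raddfMz /=.
pose l (v : S) := tens (v : SZ) y.
have l0 : l 0 = 0 by exact: (biadd0l tens_biadditive).
have lB : zmod_morphism l.
  move=> v w; apply: (@addIr _ (l w)); rewrite subrK.
  by rewrite /l -tens_biadditive.1 subrK.
pose H := GRing.isZmodMorphism.Build S (tensor SZ SZ) l lB.
pose L : {additive S -> tensor SZ SZ} := HB.pack l H.
by rewrite -[RHS]/(L (x *~ k)) raddfMz.
Qed.

Lemma sandwich_sum_tens (s : seq (S * S)) (x : S) :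
  sandwich (\sum_(p <- s) tens (p.1 : SZ) (p.2 : SZ)) (x : SZ) = sw s x.
Proof.
rewrite /sw; elim: s => [|p s IH]; first rewrite !big_nil.
  by have := sandwichB 0 0 x; rewrite subrr => ->; rewrite subrr.
rewrite !big_cons -IH -(sandwich_tens (p.1 : SZ) (p.2 : SZ) x).
set a := tens _ _; set c := \sum_(_ <- _) _.
have := sandwichB (a + c) c x; rewrite addrK => ->.
by rewrite subrK.
Qed.

(** This is surjectivity of the sandwich map, a preimage being a finite sum of pure tensors. *)
Lemma azumaya_is_sw (h : S -> S) : azumaya S ->
  (forall z x y, z \in @central S -> h (z * x + y) = z * h x + h y) -> is_sw h.
Proof.
move=> [_ _ [k _ kK]] hl.
have lin : linear (h : SZ -> SZ).
  by move=> z x y; apply: (hl (centre_val z)); case: z.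
pose H := GRing.isLinear.Build Z SZ SZ _ (h : SZ -> SZ) lin.
pose L : {linear SZ -> SZ} := HB.pack (h : SZ -> SZ) H.
have [s hs] := tens_sumP (k L).
by exists s => x; rewrite -sandwich_sum_tens -hs kK.
Qed.

(** Projectivity splits the surjection from Z(S)^n given by generators. The components of the
    splitting are Z(S)-linear, hence sandwiches by [azumaya_is_sw]. *)
Lemma azumaya_basis : azumaya S ->
  exists (n : nat) (e : 'I_n -> S) (f : 'I_n -> S -> S), az_basis e f.
Proof.
move=> azS; have [[n [e fg]] proj _] := azS.
pose p0 (c : 'rV[Z]_n) : SZ := \sum_i c 0 i *: e i.
have plin : linear p0.
  move=> z c d; rewrite /p0 scaler_sumr -big_split; apply: eq_bigr => i _ /=.
  by rewrite !mxE scalerDl scalerA.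
pose H := GRing.isLinear.Build Z _ SZ _ p0 plin.
pose p : {linear 'rV[Z]_n -> SZ} := HB.pack p0 H.
have [|h hp] := proj _ _ p idfun.
  move=> y; have [c ->] := fg y; exists (\row_i c i).
  by apply: eq_bigr => i _; rewrite mxE.
exists n, e, (fun i x => centre_val (h (x : SZ) 0 i)); split.
- move=> i; apply: azumaya_is_sw => // z x y hz.
  have -> : z * x + y = Centre hz *: (x : SZ) + (y : SZ) by [].
  by rewrite linearP !mxE.
- by move=> i x; case: (h _ _ _).
- by move=> x; rewrite -{1}[x]hp.
Qed.

Section Converse.
Variables (I : finType) (e : I -> S) (f : I -> S -> S).
Hypothesis ef : az_basis e f.

Definition az_coord i (x : S) : Z := let: And3 _ fc _ := ef in Centre (fc i x).

Lemma az_coordE i x : centre_val (az_coord i x) = f i x.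
Proof. by rewrite /az_coord; case: ef. Qed.

Lemma az_coord_linear i (z : Z) (x y : SZ) :
  az_coord i (z *: x + y) = z * az_coord i x + az_coord i y.
Proof.
apply: val_inj; rewrite /= az_coordE !az_coordE.
by case: ef => fsw _ _; apply: is_sw_linear => //; case: z.
Qed.

Lemma az_coord_basis (x : SZ) : x = \sum_i az_coord i x *: (e i : SZ).
Proof.
rewrite [LHS](let: And3 _ _ fe := ef in fe x).
by apply: eq_bigr => i _; rewrite centre_scaleE az_coordE.
Qed.

Lemma az_coordD i (x y : S) :
  az_coord i (x + y) = az_coord i x + az_coord i y.
Proof. by have := az_coord_linear i 1 x y; rewrite scale1r mul1r. Qed.

Lemma az_coord0 i : az_coord i 0 = 0.
Proof. by apply: (@addrI _ (az_coord i 0)); rewrite -az_coordD !addr0. Qed.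

Lemma az_coordZ i (z : Z) (x : S) :
  az_coord i (centre_val z * x) = z * az_coord i x.
Proof. by have := az_coord_linear i z x 0; rewrite addr0 az_coord0 addr0. Qed.

Lemma az_coord_sum i (J : Type) (r : seq J) (g : J -> S) :
  az_coord i (\sum_(k <- r) g k) = \sum_(k <- r) az_coord i (g k).
Proof.
apply: (big_morph (az_coord i)); last exact: az_coord0.
by move=> x y; exact: az_coordD.
Qed.

Lemma az_basis_projective : projective SZ.
Proof.
move=> N P p f0 psurj.
have /choice[y hy] : forall i, exists y, p y = f0 (e i) by move=> i.
pose h0 (x : SZ) : N := \sum_i az_coord i x *: y i.
have hlin : linear h0.
  move=> z x x'; rewrite /h0 scaler_sumr -big_split; apply: eq_bigr => i _ /=.
  by rewrite az_coord_linear scalerDl scalerA.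
pose H := GRing.isLinear.Build Z SZ N _ h0 hlin.
pose h : {linear SZ -> N} := HB.pack h0 H.
exists h => x; rewrite /h /= /h0.
rewrite linear_sum [in RHS](az_coord_basis x) linear_sum.
by apply: eq_bigr => i _; rewrite !linearZ /= hy.
Qed.

Lemma az_basis_fg : finitely_generated SZ.
Proof.
exists #|I|, (fun i => e (enum_val i)) => x.
exists (fun i => az_coord (enum_val i) x).
by rewrite {1}[x]az_coord_basis (reindex _ (onW_bij _ (@enum_val_bij I))).
Qed.

(** Injectivity is [az_balanced0] for the universal balanced map [tens]; surjectivity holds since
    h(x) = sum_i f_i(x) h(e_i) and each f_i is a sandwich. *)
Lemma az_basis_azumaya : azumaya S.
Proof.
split; [exact: az_basis_fg|exact: az_basis_projective|].
have inj : injective (@sandwich S).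
  move=> t u tu; apply/eqP; rewrite -subr_eq0; apply/eqP.
  have [s hs] := tens_sumP (t - u); rewrite hs.
  apply: (@az_balanced0 S _ _ I e f ef tens_biadditive tens_balanced) => x.
  by rewrite -sandwich_sum_tens -hs sandwichB tu subrr.
have surj : forall h, exists t, sandwich t = h :> {linear SZ -> SZ}.
  move=> h.
  have [s hs] : is_sw (h : S -> S).
    apply: (@eq_is_sw _ (fun x => \sum_i f i x * h (e i))).
      move=> x; rewrite [in RHS](az_coord_basis x) linear_sum /=.
      by apply: eq_bigr => i _; rewrite linearZ /= centre_scaleE az_coordE.
    apply: is_sw_sum => i; case: ef => fsw _ _.
    by apply: eq_is_sw (is_sw_scale 1 (h (e i)) (fsw i)) => x; rewrite mul1r.
  exists (\sum_(p <- s) tens (p.1 : SZ) (p.2 : SZ)); apply: eq_linear_fun => x.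
  by rewrite sandwich_sum_tens -hs.
have [k hk] := choice surj; exists k => // t.
by apply: inj; rewrite hk.
Qed.

End Converse.
End AzumayaBasis.

(** * Crossed products and X-outer actions *)

Section Coefficients.
Variables (A : nzRingType) (G : finGroupType) (T : nzRingType).
Variable X : crossed_product A G T.
Local Notation inc := (cp_in X).
Local Notation bar := (cp_bar X).
Local Notation act := (cp_act X).

Fact cp_act_zmod g : zmod_morphism (act g).
Proof. by move=> a b; apply: cp_act_uniq; rewrite !rmorphB mulrBr mulrBl !cp_actE. Qed.

Fact cp_act_monoid g : monoid_morphism (act g).
Proof.
by split; [apply: cp_act_uniq; rewrite rmorph1 mulr1 mul1r|exact: cp_actM].
Qed.

HB.instance Definition _ g :=
  GRing.isZmodMorphism.Build A A (act g) (cp_act_zmod g).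
HB.instance Definition _ g :=
  GRing.isMonoidMorphism.Build A A (act g) (cp_act_monoid g).

Lemma cp_mulI g : injective (fun t => t * bar g).
Proof.
have [v [_ uv]] := cp_bar_unit X g => s t /(congr1 ( *%R^~ v)) /=.
by rewrite -!mulrA uv !mulr1.
Qed.

Lemma cp_act_inj g : injective (act g).
Proof.
have [v [vu _]] := cp_bar_unit X g => a b ab; apply: (@cp_in_inj _ _ _ X).
rewrite -[LHS]mul1r -[RHS]mul1r -vu -!mulrA.
by rewrite (cp_actE X) ab -(cp_actE X).
Qed.

Lemma cp_act_bij g : bijective (act g).
Proof.
have /choice[f fK] := cp_act_surj X g.
by exists f => // a; apply: (@cp_act_inj g); rewrite fK.
Qed.

Lemma cp_act1 a : act 1%g a = a.
Proof. by apply: cp_act_uniq; rewrite cp_bar1 mul1r mulr1. Qed.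

Lemma cp_act_centralE g z : z \in @central A -> act g z \in @central A.
Proof. by move=> hz; have := cp_act_central X g (Centre hz). Qed.

Fact cp_coef_subproof (t : T) :
  exists c : {ffun G -> A}, t = \sum_(g : G) inc (c g) * bar g.
Proof. by have [c [h _]] := cp_basis X t; exists c. Qed.

Definition cp_coef (t : T) : {ffun G -> A} := sval (cid (cp_coef_subproof t)).

Lemma cp_coefE t : t = \sum_g inc (cp_coef t g) * bar g.
Proof. exact: svalP (cid (cp_coef_subproof t)). Qed.

Lemma cp_coef_uniq t (c : G -> A) :
  t = \sum_g inc (c g) * bar g -> forall g, cp_coef t g = c g.
Proof.
move=> tc g; have [d [_ du]] := cp_basis X t.
have -> : cp_coef t = [ffun g => c g]; last by rewrite ffunE.
rewrite -(du _ (cp_coefE t)); apply: du; rewrite {1}tc.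
by apply: eq_bigr => h _; rewrite ffunE.
Qed.

Lemma eq_cp_coef s t : (forall g, cp_coef s g = cp_coef t g) -> s = t.
Proof. by move=> st; rewrite [s]cp_coefE [t]cp_coefE; apply: eq_bigr => g _; rewrite st. Qed.

(** The group element comes first so that each coefficient function can carry an additive
    structure. *)
Definition cp_coef_at g (t : T) := cp_coef t g.

Fact cp_coef_zmod g : zmod_morphism (cp_coef_at g).
Proof.
move=> s t; apply: (@cp_coef_uniq _ (fun g => cp_coef s g - cp_coef t g)).
rewrite {1}[s]cp_coefE {1}[t]cp_coefE -sumrB; apply: eq_bigr => h _.
by rewrite rmorphB mulrBl.
Qed.

HB.instance Definition _ g :=
  GRing.isZmodMorphism.Build T A (cp_coef_at g) (cp_coef_zmod g).

Lemma cp_coefB g s t : cp_coef (s - t) g = cp_coef s g - cp_coef t g.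
Proof. exact: cp_coef_zmod. Qed.

Lemma cp_coef0 g : cp_coef 0 g = 0.
Proof. exact: (raddf0 (cp_coef_at g)). Qed.

Lemma cp_coefN g t : cp_coef (- t) g = - cp_coef t g.
Proof. exact: (raddfN (cp_coef_at g)). Qed.

Lemma cp_coefD g s t : cp_coef (s + t) g = cp_coef s g + cp_coef t g.
Proof. exact: (raddfD (cp_coef_at g)). Qed.

Lemma cp_coef_sum g (I : Type) (r : seq I) (P : pred I) (F : I -> T) :
  cp_coef (\sum_(i <- r | P i) F i) g = \sum_(i <- r | P i) cp_coef (F i) g.
Proof. exact: (raddf_sum (cp_coef_at g)). Qed.

Lemma cp_coef_inl a t g : cp_coef (inc a * t) g = a * cp_coef t g.
Proof.
apply: (@cp_coef_uniq _ (fun g => a * cp_coef t g)); rewrite {1}[t]cp_coefE mulr_sumr.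
by apply: eq_bigr => h _; rewrite rmorphM mulrA.
Qed.

Lemma cp_coef_inr a t g : cp_coef (t * inc a) g = cp_coef t g * act g a.
Proof.
apply: (@cp_coef_uniq _ (fun g => cp_coef t g * act g a)).
rewrite {1}[t]cp_coefE mulr_suml.
by apply: eq_bigr => h _; rewrite rmorphM -!mulrA (cp_actE X).
Qed.

Lemma cp_coef_bar a h g : cp_coef (inc a * bar h) g = a *+ (g == h).
Proof.
apply: (@cp_coef_uniq _ (fun g => a *+ (g == h))).
rewrite (bigD1 h) //= eqxx mulr1n big1 ?addr0 // => k /negPf->.
by rewrite mulr0n rmorph0 mul0r.
Qed.

Lemma cp_coef_in a g : cp_coef (inc a) g = a *+ (g == 1%g).
Proof. by rewrite -[inc a]mulr1 -(cp_bar1 X) cp_coef_bar. Qed.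

(** Both inclusions of [cp_mul] are used: each product spans the other over [A], and the two
    coefficients are mutually inverse. *)
Fact cp_cocycle_subproof g h :
  exists a, bar g * bar h = inc a * bar (g * h)%g /\ is_unit a.
Proof.
have ran := cp_mul X g h.
have [a _ ha] : range (fun a => inc a * bar (g * h)%g) (bar g * bar h).
  by rewrite -ran; exists 1; rewrite // rmorph1 mul1r.
have [b _ hb] : range (fun a => inc a * (bar g * bar h)) (bar (g * h)%g).
  by rewrite ran; exists 1; rewrite // rmorph1 mul1r.
exists a; split=> //; exists b; split; apply: (@cp_in_inj _ _ _ X).
  by apply: (@cp_mulI (g * h)%g); rewrite rmorphM -mulrA ha hb rmorph1 mul1r.
apply: (@cp_mulI g); apply: (@cp_mulI h).
by rewrite rmorphM -!mulrA hb ha rmorph1 mul1r.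
Qed.

Definition cp_cocycle g h : A := sval (cid (cp_cocycle_subproof g h)).

Lemma cp_barM g h : bar g * bar h = inc (cp_cocycle g h) * bar (g * h)%g.
Proof. by rewrite /cp_cocycle; case: (cid _) => a []. Qed.

Lemma cp_cocycle_unit g h : is_unit (cp_cocycle g h).
Proof. by rewrite /cp_cocycle; case: (cid _) => a []. Qed.

Lemma cp_coef_mulbar t h g : cp_coef (t * bar h) (g * h)%g = cp_coef t g * cp_cocycle g h.
Proof.
rewrite [t in LHS]cp_coefE mulr_suml cp_coef_sum (bigD1 g) //= -mulrA cp_barM mulrA.
rewrite -rmorphM cp_coef_bar eqxx mulr1n big1 ?addr0 // => k kg.
by rewrite -mulrA cp_barM mulrA -rmorphM cp_coef_bar (inj_eq (mulIg h)) eq_sym (negPf kg).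
Qed.

Lemma cp_cocycle11 : cp_cocycle 1%g 1%g = 1.
Proof.
apply: (@cp_in_inj _ _ _ X); rewrite rmorph1.
by have := cp_barM 1%g 1%g; rewrite mulg1 !cp_bar1 !mulr1.
Qed.

Lemma cp_coef_mul1 u v : cp_coef (u * v) 1%g =
  \sum_h cp_coef u h * act h (cp_coef v h^-1%g) * cp_cocycle h h^-1%g.
Proof.
rewrite [v in LHS]cp_coefE mulr_sumr cp_coef_sum (reindex_inj invg_inj).
apply: eq_bigr => h _; rewrite mulrA.
by rewrite -[X in cp_coef _ X](mulgV h) cp_coef_mulbar cp_coef_inr.
Qed.

(** [act (g * h)] and [act g \o act h] differ by conjugation by the cocycle, which is trivial on the
    centre. *)
Lemma cp_actM_central g h z : z \in @central A ->
  act (g * h)%g z = act g (act h z).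
Proof.
move=> hz; have [b [_ ab]] := cp_cocycle_unit g h.
have : bar g * bar h * inc z = inc (act g (act h z)) * (bar g * bar h).
  by rewrite -mulrA (cp_actE X) mulrA (cp_actE X) mulrA.
rewrite cp_barM -mulrA (cp_actE X) !mulrA -!rmorphM => /cp_mulI/(@cp_in_inj _ _ _ X).
rewrite -((centralP _ (cp_act_centralE (g * h)%g hz)) (cp_cocycle g h)).
by move=> /(congr1 ( *%R^~ b)); rewrite -!mulrA ab !mulr1.
Qed.

End Coefficients.

(** * Twisted bimodule maps and X-inner automorphisms *)

Section Martindale.
Variables (A Q : nzRingType) (j : {rmorphism A -> Q}).
Hypotheses (A_prime : prime_ring A) (Q_mart : symmetric_martindale j).

(** On [L'], the image of [L] under [s], the map [f \o s'] is right linear and f(a) b = a f(s'(b)),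
    so the extension axiom of Q_s makes [f] right multiplication by some [q]. Computing f(a r) in
    two ways shows that [L] kills r q - q s(r). *)
Lemma twisted_extends (L L' : set A) (f : A -> A) (s s' : A -> A) :
  nonzero_ideal L -> cancel s s' -> cancel s' s ->
  {morph s : a b / a + b} -> {morph s : a b / a * b} ->
  (forall a, L' a <-> exists2 b, L b & a = s b) ->
  (forall a b, L a -> L b -> f (a + b) = f a + f b) ->
  (forall r a, L a -> f (r * a) = r * f a) ->
  (forall r a, L a -> f (a * r) = f a * s r) ->
  exists q, (forall a, L a -> j (f a) = j a * q) /\
            (forall r, j r * q = q * j (s r)).
Proof.
move=> L0 sK s'K sD sM L'P fD fl fr.
have [[[L_0 LD Ll] [_ _ Lr]] [a0 La0 a0n]] := L0.
have s'D : {morph s' : a b / a + b}.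
  by move=> a b; apply: (can_inj sK); rewrite sD !s'K.
have s'M : {morph s' : a b / a * b}.
  by move=> a b; apply: (can_inj sK); rewrite sM !s'K.
have s0 : s 0 = 0 by apply: (@addrI _ (s 0)); rewrite -sD !addr0.
have L'0 : nonzero_ideal L'.
  have cl : (forall a b, L' a -> L' b -> L' (a + b)) /\ L' 0.
    split; last by apply/L'P; exists 0.
    move=> a b /L'P[c Lc ->] /L'P[d Ld ->]; apply/L'P; exists (c + d); first exact: LD.
    by rewrite sD.
  split; last first.
    exists (s a0); first by apply/L'P; exists a0.
    by apply: contra_neq a0n => h; apply: (can_inj sK); rewrite h s0.
  split; split=> [||r a /L'P[c Lc ->]]; try by case: cl.
    by apply/L'P; exists (s' r * c); [exact: Ll|rewrite sM s'K].
  by apply/L'P; exists (c * s' r); [exact: Lr|rewrite sM s'K].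
have [_ _ Q2 Q3] := Q_mart.
have L's' b : L' b -> L (s' b) by move=> /L'P[c Lc ->]; rewrite sK.
have [|||q [q1 _]] := @Q3 L L' f (f \o s') L0 L'0 fD fl.
- by move=> a b /L's' La /L's' Lb; rewrite /= s'D fD.
- by move=> r a /L's' La; rewrite /= s'M fr // s'K.
- by move=> a b La /L's' Lb; rewrite /= -fl // -[b in LHS]s'K -fr.
exists q; split=> // r.
apply/eqP; rewrite -subr_eq0; apply/eqP; apply: (Q2 _ L) => //.
left=> a La; rewrite mulrBr !mulrA -q1 // -rmorphM -q1; last exact: Lr.
by rewrite fr // rmorphM subrr.
Qed.

(** Primeness makes a nonzero [f] injective. Then [twisted_extends] applies to [f] and, with twist
    [s'], to its inverse on the ideal f(L); the two elements of [Q] obtained are mutually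
    inverse. *)
Lemma twisted_x_inner (L : set A) (f : A -> A) (s : A -> A) :
  nonzero_ideal L -> bijective s ->
  {morph s : a b / a + b} -> {morph s : a b / a * b} ->
  (forall a b, L a -> L b -> f (a + b) = f a + f b) ->
  (forall r a, L a -> f (r * a) = r * f a) ->
  (forall r a, L a -> f (a * r) = f a * s r) ->
  (exists2 a, L a & f a != 0) ->
  exists q q' : Q, [/\ q * q' = 1, q' * q = 1 & forall r, j r * q = q * j (s r)].
Proof.
move=> L0 [s' sK s'K] sD sM fD fl fr [a1 La1 fa1].
have [[[L_0 LD Ll] [_ _ Lr]] _] := L0.
have s'D : {morph s' : a b / a + b}.
  by move=> a b; apply: (can_inj sK); rewrite sD !s'K.
have s'M : {morph s' : a b / a * b}.
  by move=> a b; apply: (can_inj sK); rewrite sM !s'K.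
have f0 : f 0 = 0 by apply: (@addrI _ (f 0)); rewrite -fD // !addr0.
have fN a : L a -> f (- a) = - f a by move=> La; rewrite -mulN1r fl // mulN1r.
pose L' : set A := fun b => exists2 a, L a & b = f a.
have L'0 : nonzero_ideal L'.
  split; last by exists (f a1) => //; exists a1.
  have ad : forall a b, L' a -> L' b -> L' (a + b).
    by move=> _ _ [c Lc ->] [d Ld ->]; exists (c + d); [exact: LD|rewrite fD].
  split; split=> // [|r _ [c Lc ->]]; try by exists 0.
    by exists (r * c); [exact: Ll|rewrite fl].
  by exists (c * s' r); [exact: Lr|rewrite fr // s'K].
(* The kernel of f annihilates its image, and both are ideals. *)
have f_ker a : L a -> f a = 0 -> a = 0.
  move=> La fa.
  have [|||K0|K0] := A_prime (I := fun a => L a /\ f a = 0) (J := L').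
  - split; split=> // [b c [Lb fb] [Lc fc]|r b [Lb fb]].
    + by split; [exact: LD|rewrite fD // fb fc addr0].
    + by split; [exact: Ll|rewrite fl // fb mulr0].
    + by split; [exact: LD|rewrite fD // fb fc addr0].
    + by split; [exact: Lr|rewrite fr // fb mul0r].
  - by case: L'0.
  - by move=> b _ [Lb fb] [c Lc ->]; rewrite -fl // fr // fb mul0r.
  - by have : [set 0]%classic a by rewrite -K0.
  - case: L'0 => _ [b L'b]; rewrite K0 in L'b; by rewrite L'b eqxx.
have f_inj a b : L a -> L b -> f a = f b -> a = b.
  move=> La Lb ab; apply/eqP; rewrite -subr_eq0; apply/eqP.
  apply: f_ker; first by apply: LD => //; rewrite -mulN1r; apply: Ll.
  by rewrite fD ?fN ?ab ?subrr // -mulN1r; apply: Ll.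
have /choice[h hP] : forall b, exists a, L' b -> L a /\ f a = b.
  move=> b; case: (pselect (L' b)) => [[a La ->]|nb]; last by exists 0.
  by exists a.
have [|q [q1 q2]] := @twisted_extends L (fun a => exists2 b, L b & a = s b) f s s'
  L0 sK s'K sD sM _ fD fl fr; first by [].
have [[[_ L'D L'l] [_ _ L'r]] _] := L'0.
have [||||q' [q'1 q'2]] := @twisted_extends L'
  (fun a => exists2 b, L' b & a = s' b) h s' s L'0 s'K sK s'D s'M; first by [].
- move=> a b L'a L'b; have [La fa] := hP a L'a; have [Lb fb] := hP b L'b.
  have [Lab fab] := hP _ (L'D _ _ L'a L'b).
  by apply: f_inj => //; [exact: LD|rewrite fab fD // fa fb].
- move=> r a L'a; have [La fa] := hP a L'a; have [Lra fra] := hP _ (L'l r _ L'a).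
  by apply: f_inj => //; [exact: Ll|rewrite fra fl // fa].
- move=> r a L'a; have [La fa] := hP a L'a; have [Lra fra] := hP _ (L'r r _ L'a).
  by apply: f_inj => //; [exact: Lr|rewrite fra fr // fa s'K].
have [_ _ Q2 _] := Q_mart.
exists q, q'; split=> //.
  apply/eqP; rewrite -subr_eq0; apply/eqP; apply: (Q2 _ L) => //; left=> a La.
  have L'fa : L' (f a) by exists a.
  have [Lhfa fhfa] := hP _ L'fa.
  rewrite mulrBr mulr1 mulrA -q1 // -q'1 //.
  by rewrite (f_inj _ _ Lhfa La fhfa) subrr.
apply/eqP; rewrite -subr_eq0; apply/eqP; apply: (Q2 _ L') => //; left=> a L'a.
have [La fa] := hP _ L'a.
by rewrite mulrBr mulr1 mulrA -q'1 // -q1 // fa subrr.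
Qed.

End Martindale.

Lemma ideal_opp (R : nzRingType) (I : set R) a : left_ideal I -> I a -> I (- a).
Proof. by case=> _ _ Il Ia; rewrite -mulN1r; apply: Il. Qed.

Lemma right_ideal_opp (R : nzRingType) (I : set R) a : right_ideal I -> I a -> I (- a).
Proof. by case=> _ _ Ir Ia; rewrite -mulrN1; apply: Ir. Qed.

(** The ideal zR and the annihilator of [z] have product zero. *)
Lemma prime_central_regular (R : nzRingType) (z a : R) : prime_ring R ->
  z \in @central R -> z != 0 -> z * a = 0 -> a = 0.
Proof.
move=> pR /centralP hz z0 za.
have [|||Z0|Z0] := pR (fun x => exists y, x = z * y) (fun x => z * x = 0).
- split; split=> [|_ _ [b ->] [c ->]|r _ [b ->]].
  + by exists 0; rewrite mulr0.
  + by exists (b + c); rewrite mulrDr.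
  + by exists (r * b); rewrite mulrA -hz mulrA.
  + by exists 0; rewrite mulr0.
  + by exists (b + c); rewrite mulrDr.
  + by exists (b * r); rewrite mulrA.
- split; split=> [|b c hb hc|r b hb]; rewrite ?mulr0 ?mulrDr ?hb ?hc ?addr0 //.
  + by rewrite mulrA hz -mulrA hb mulr0.
  + by rewrite mulrA hb mul0r.
- by move=> _ b [y ->] zb; rewrite hz -mulrA zb mulr0.
- have : [set 0]%classic z by rewrite -Z0; exists 1; rewrite mulr1.
  by move=> /eqP; rewrite (negPf z0).
- have : [set 0]%classic a by rewrite -Z0.
  by [].
Qed.

(** * Chain conditions for the crossed product *)

Section Noetherian.
Variables (A : nzRingType) (G : finGroupType) (T : nzRingType).
Variable X : crossed_product A G T.

(** Leading coefficients as in Hilbert's basis theorem, with [G] ordered by [enum_rank]. *)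
Definition lead (g : G) (I : set T) : set A := fun a =>
  exists t, [/\ I t, cp_coef X t g = a
    & forall h : G, (enum_rank g < enum_rank h)%N -> cp_coef X t h = 0].

(** The leading coefficients stabilise for each of the finitely many g; past the largest index,
    leading terms can be cancelled by elements of the earlier ideal. Abstract [PA] and [PT] cover
    left and right ideals at once. *)
Lemma acc_lead (PA : set A -> Prop) (PT : set T -> Prop) :
  (forall I, PT I -> [/\ I 0, forall s t, I s -> I t -> I (s + t)
                       & forall t, I t -> I (- t)]) ->
  (forall I g, PT I -> PA (lead g I)) -> acc PA -> acc PT.
Proof.
move=> PTz PTl accA I PI sI.
have mono m n : (m <= n)%N -> (I m `<=` I n)%classic.
  elim: n => [|n IH]; first by rewrite leqn0 => /eqP->.
  rewrite leq_eqVlt => /orP[/eqP->//|/IH h t It]; exact/sI/h.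
have lead_mono g m n : (m <= n)%N -> (lead g (I m) `<=` lead g (I n))%classic.
  by move=> mn a [t [It ta t0]]; exists t; split=> //; exact: mono It.
have /choice[N hN] : forall g, exists N, forall n, (N <= n)%N ->
    lead g (I n) = lead g (I N).
  move=> g; apply: (accA (fun n => lead g (I n))) => [n|n]; first exact: PTl.
  exact: lead_mono.
exists (\max_g N g) => n Mn; apply/seteqP; split; last exact: mono.
(* [k] bounds the ranks at which [t] may have nonzero coefficients: [#|G|] is no restriction, and 0
   forces t = 0. *)
suff H k t : (k <= #|G|)%N -> I n t ->
    (forall h : G, (k <= enum_rank h)%N -> cp_coef X t h = 0) -> I (\max_g N g) t.
  move=> t It; apply: (H #|G|) => // h; by rewrite leqNgt ltn_ord.
have [IM0 IMD _] := PTz _ (PI (\max_g N g)).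
have [_ InD InN] := PTz _ (PI n).
elim: k t => [|k IH] t kG It tk.
  by have -> : t = 0 by apply: (@eq_cp_coef _ _ _ X) => h; rewrite tk // cp_coef0.
pose g := enum_val (Ordinal kG).
have gk : enum_rank g = k :> nat by rewrite /g enum_valK.
have : lead g (I n) (cp_coef X t g) by exists t; split=> // h; rewrite gk; apply: tk.
rewrite (hN g n); last by apply: leq_trans Mn; apply: leq_bigmax.
move=> /(lead_mono _ _ (\max_g N g) (leq_bigmax g)) [s [Is sg sh]].
rewrite -(subrK s t); apply: IMD => //; apply: IH; first exact: ltnW.
  by apply: InD => //; apply: InN; apply: mono Is.
move=> h; rewrite leq_eqVlt => /orP[/eqP kh|kh]; rewrite cp_coefB.
  suff -> : h = g by rewrite sg subrr.
  by apply: enum_rank_inj; apply: val_inj; rewrite /= gk.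
by rewrite tk // sh ?subr0 // gk.
Qed.

Lemma crossed_product_noetherian : noetherian A -> noetherian T.
Proof.
move=> [accl accr]; split.
- apply: acc_lead accl => [I PI|I g [I0 ID Il]].
    by split=> [||t]; case: (PI) => // *; apply: ideal_opp.
  split=> [|_ _ [s [Is <- sh]] [t [It <- th]]|r _ [t [It <- th]]].
  + by exists 0; split=> // [|h _]; rewrite cp_coef0.
  + exists (s + t); split=> [||h gh]; [exact: ID|by rewrite cp_coefD|].
    by rewrite cp_coefD sh // th // addr0.
  + exists (cp_in X r * t); split=> [||h gh]; [exact: Il|by rewrite cp_coef_inl|].
    by rewrite cp_coef_inl th // mulr0.
- apply: acc_lead accr => [I PI|I g [I0 ID Ir]].
    by split=> [||t]; case: (PI) => // *; apply: right_ideal_opp.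
  split=> [|_ _ [s [Is <- sh]] [t [It <- th]]|r _ [t [It <- th]]].
  + by exists 0; split=> // [|h _]; rewrite cp_coef0.
  + exists (s + t); split=> [||h gh]; [exact: ID|by rewrite cp_coefD|].
    by rewrite cp_coefD sh // th // addr0.
  (* Right multiplication by [r'] acts on the coefficient at [g] through [act g], so a preimage of
     [r] is taken. *)
  + have [r' <-] := cp_act_surj X g r.
    exists (t * cp_in X r'); split=> [||h gh]; [exact: Ir|by rewrite cp_coef_inr|].
    by rewrite cp_coef_inr th // mul0r.
Qed.

End Noetherian.

(** * X-outer actions: primeness and the centre of the crossed product *)

Section XOuter.
Variables (A : nzRingType) (G : finGroupType) (T : nzRingType).
Variable X : crossed_product A G T.
Variables (Q : nzRingType) (j : {rmorphism A -> Q}).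
Hypotheses (A_prime : prime_ring A) (Q_mart : symmetric_martindale j).
Hypothesis X_out : x_outer X j.
Local Notation inc := (cp_in X).
Local Notation bar := (cp_bar X).
Local Notation act := (cp_act X).
Local Notation cp_coef := (cp_coef X).

(** A nonzero value would, by [twisted_x_inner], make [act g] conjugation by a unit of [Q], against
    X-outerness. *)
Lemma twisted_eq0 g (L : set A) (f : A -> A) : g != 1%g -> ideal L ->
  (forall a b, L a -> L b -> f (a + b) = f a + f b) ->
  (forall r a, L a -> f (r * a) = r * f a) ->
  (forall r a, L a -> f (a * r) = f a * act g r) ->
  forall a, L a -> f a = 0.
Proof.
move=> g1 idL fD fl fr a La; apply: contraNeq g1 => fa; apply/eqP/X_out.
have a0 : a != 0.
  by apply: contraNneq fa => ->; rewrite -[X in f X](mul0r a) fl // mul0r.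
have L0 : nonzero_ideal L by split=> //; exists a.
have [|q [q' [qq' q'q qs]]] :=
  @twisted_x_inner _ _ j A_prime Q_mart L f (act g) L0 (cp_act_bij X g)
    (@raddfD _ _ (act g)) (@rmorphM _ _ (act g)) fD fl fr.
  by exists a.
by exists q', q; split=> // b; rewrite -mulrA qs mulrA q'q mul1r.
Qed.

Lemma twisted_scalar0 g c : g != 1%g -> (forall a, a * c = c * act g a) -> c = 0.
Proof.
move=> g1 hc; rewrite -[c]mul1r.
apply: (@twisted_eq0 g setT (fun a => a * c) g1) => //= [a b _ _|r a _|r a _].
- by rewrite mulrDl.
- by rewrite mulrA.
- by rewrite -mulrA hc mulrA.
Qed.

Definition supp t := [set g | cp_coef t g != 0].

Lemma suppPn t g : reflect (cp_coef t g = 0) (g \notin supp t).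
Proof. by rewrite inE negbK; apply: eqP. Qed.

(** An element of [I] of minimal support containing 1 is used. Within that support, an element of
    [I] is determined by its coefficient at 1, and passing to the coefficient at g is a map twisted
    by [act g]; it vanishes for g <> 1. *)
Lemma ideal_meets_coefficients (I : set T) : nonzero_ideal I ->
  exists2 a, a != 0 & I (inc a).
Proof.
move=> [[[I0 ID Il] [_ _ Ir]] [t0 It0 t0n]].
have IN := @ideal_opp _ I _ (And3 I0 ID Il).
suff H n t : I t -> t != 0 -> (#|supp t| <= n)%N -> exists2 a, a != 0 & I (inc a).
  exact: (H #|supp t0| t0).
elim: n t => [|n IH] t It tn sn.
  case/eqP: tn; apply: (@eq_cp_coef _ _ _ X) => g; rewrite cp_coef0; apply/suppPn.
  by move: sn; rewrite leqn0 cards_eq0 => /eqP->; rewrite inE.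
(* Translate the support so that it contains 1. *)
have [h th] : exists h, cp_coef t h != 0.
  apply/existsP; apply: contraNT tn; rewrite negb_exists => /forallP t0'.
  apply/eqP/(@eq_cp_coef _ _ _ X) => g; rewrite cp_coef0.
  by have := t0' g; rewrite negbK => /eqP.
pose s := t * bar h^-1%g.
have Is : I s by exact: Ir.
have s1 : cp_coef s 1%g != 0.
  rewrite -[1%g](mulgV h) cp_coef_mulbar; have [v [_ gv]] := cp_cocycle_unit X h h^-1%g.
  by apply: contraNneq th => /(congr1 ( *%R^~ v)); rewrite mul0r -mulrA gv mulr1 => ->.
have ss : (#|supp s| <= n.+1)%N.
  apply: leq_trans sn; rewrite -(card_imset (supp t) (mulIg h^-1%g)).
  apply: subset_leq_card; apply/fintype.subsetP => g; rewrite inE => sg.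
  apply/imsetP; exists (g * h)%g; last by rewrite mulgK.
  rewrite inE; apply: contraNneq sg => tgh.
  by rewrite -[g](mulgK h) cp_coef_mulbar tgh mul0r.
(* If [I] has a nonzero element of smaller support, induction applies to it; otherwise the support
   of [s] is minimal. *)
have [[u [Iu un us]]|nu] := pselect (exists u, [/\ I u, u != 0 & (#|supp u| <= n)%N]).
  exact: IH Iu un us.
have small u : I u -> supp u \proper supp s -> u = 0.
  move=> Iu us; apply/eqP; apply/negPn/negP => un; apply: nu; exists u; split=> //.
  by rewrite -ltnS; apply: leq_trans ss; apply: proper_card.
have [[g [g1 sg]]|ng] := pselect (exists g, g != 1%g /\ cp_coef s g != 0); last first.
  exists (cp_coef s 1%g) => //; suff -> : inc (cp_coef s 1%g) = s by [].
  apply: (@eq_cp_coef _ _ _ X) => g; rewrite cp_coef_in.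
  have [->|g1] := eqVneq g 1%g; first by rewrite mulr1n.
  by rewrite mulr0n; apply/esym/eqP/negPn/negP => sg; apply: ng; exists g.
pose L : set A := fun a => exists u, [/\ I u, supp u \subset supp s & cp_coef u 1%g = a].
have suppD u v : supp u \subset supp s -> supp v \subset supp s ->
    supp (u + v) \subset supp s.
  move=> /fintype.subsetP us /fintype.subsetP vs; apply/fintype.subsetP => k.
  apply: contraLR => ks.
  have /suppPn u0 := contra (us k) ks; have /suppPn v0 := contra (vs k) ks.
  by apply/suppPn; rewrite cp_coefD u0 v0 addr0.
have suppN u : supp (- u) = supp u.
  by apply/setP => k; rewrite !inE cp_coefN oppr_eq0.
have suppl r u : supp u \subset supp s -> supp (inc r * u) \subset supp s.
  apply/fintype.subset_trans/fintype.subsetP => k; apply: contraLR => /suppPn u0.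
  by apply/suppPn; rewrite cp_coef_inl u0 mulr0.
have suppr r u : supp u \subset supp s -> supp (u * inc r) \subset supp s.
  apply/fintype.subset_trans/fintype.subsetP => k; apply: contraLR => /suppPn u0.
  by apply/suppPn; rewrite cp_coef_inr u0 mul0r.
have uniq u v : I u -> I v -> supp u \subset supp s -> supp v \subset supp s ->
    cp_coef u 1%g = cp_coef v 1%g -> u = v.
  move=> Iu Iv us vs uv; apply/eqP; rewrite -subr_eq0; apply/eqP; apply: small.
    by apply: ID => //; apply: IN.
  apply/properP; split; first by apply: suppD; rewrite ?suppN.
  by exists 1%g; rewrite !inE // cp_coefB uv subrr eqxx.
(* [w] recovers from a coefficient at 1 the element of [I], unique by [uniq], that carries it. *)
have /choice[w wP] : forall a, exists u, L a ->
    [/\ I u, supp u \subset supp s & cp_coef u 1%g = a].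
  move=> a; case: (pselect (L a)) => [[u hu]|na]; last by exists 0.
  by exists u.
have LD a b : L a -> L b -> L (a + b).
  move=> [u [Iu us <-]] [v [Iv vs <-]]; exists (u + v).
  by split; [exact: ID|exact: suppD|rewrite cp_coefD].
have Ll r a : L a -> L (r * a).
  move=> [u [Iu us <-]]; exists (inc r * u).
  by split; [exact: Il|exact: suppl|rewrite cp_coef_inl].
have Lr r a : L a -> L (a * r).
  move=> [u [Iu us <-]]; exists (u * inc r).
  by split; [exact: Ir|exact: suppr|rewrite cp_coef_inr cp_act1].
have L0 : L 0.
  exists 0; split=> //; rewrite ?cp_coef0 //; apply/fintype.subsetP => k.
  by rewrite inE cp_coef0 eqxx.
have Ls : L (cp_coef s 1%g) by exists s.
case/eqP: sg.
have <- : w (cp_coef s 1%g) = s.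
  by have [Iw ws w1] := wP _ Ls; apply: uniq.
apply: (@twisted_eq0 g L (fun a => cp_coef (w a) g) g1) => // [a b La Lb|r a La|r a La].
- have [Ia sa a1] := wP _ La; have [Ib sb b1] := wP _ Lb.
  have [Iab sab ab1] := wP _ (LD _ _ La Lb).
  rewrite -cp_coefD; congr (fun_of_fin (cp_coef _) _).
  by apply: uniq => //; [exact: ID|exact: suppD|rewrite cp_coefD a1 b1].
- have [Ia sa a1] := wP _ La; have [Ira sra ra1] := wP _ (Ll r _ La).
  rewrite -cp_coef_inl; congr (fun_of_fin (cp_coef _) _).
  by apply: uniq => //; [exact: Il|exact: suppl|rewrite cp_coef_inl a1].
- have [Ia sa a1] := wP _ La; have [Iar sar ar1] := wP _ (Lr r _ La).
  rewrite -cp_coef_inr; congr (fun_of_fin (cp_coef _) _).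
  by apply: uniq => //; [exact: Ir|exact: suppr|rewrite cp_coef_inr cp_act1 a1].
Qed.

(** Nonzero ideals of [T] meet [A] in nonzero ideals, to which primeness of [A] applies. *)
Lemma crossed_product_prime : prime_ring T.
Proof.
have nz (I : set T) : ideal I -> I != [set 0]%classic -> nonzero_ideal I.
  move=> idI I0; split=> //; apply: contrapT => nI; case/eqP: I0.
  apply/seteqP; split=> [a Ia|_ ->]; last by case: idI => [[]].
  by apply/eqP/negPn/negP => a0; apply: nI; exists a.
have res (I : set T) : ideal I -> ideal (fun a => I (inc a)).
  move=> [[I0 ID Il] [_ _ Ir]]; split; split; rewrite ?rmorph0 // => a b.
  - by rewrite rmorphD; apply: ID.
  - by rewrite rmorphM; apply: Il.
  - by rewrite rmorphD; apply: ID.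
  - by rewrite rmorphM; apply: Ir.
move=> I J idI idJ IJ.
have [I0|/(nz _ idI)/ideal_meets_coefficients[a a0 Ia]] := eqVneq I [set 0]%classic.
  by left.
have [J0|/(nz _ idJ)/ideal_meets_coefficients[b b0 Jb]] := eqVneq J [set 0]%classic.
  by right.
have [a' b' Ia' Jb'|K0|K0] := A_prime (res I idI) (res J idJ).
- by apply: (@cp_in_inj _ _ _ X); rewrite rmorphM rmorph0; apply: IJ.
- have : [set 0]%classic a by rewrite -K0.
  by move=> /eqP; rewrite (negPf a0).
- have : [set 0]%classic b by rewrite -K0.
  by move=> /eqP; rewrite (negPf b0).
Qed.

(** Commuting with [A] gives a c = c g(a) for the coefficient c at g, so only the coefficient at 1
    survives; commuting with [A] and with each [bar g] makes it central and invariant. *)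
Lemma central_crossedP r : reflect
  (exists z, [/\ z \in @central A, r = inc z & forall g, act g z = z])
  (r \in @central T).
Proof.
apply: (iffP idP) => [/centralP hr|[z [/centralP hz -> zG]]].
  have rE : r = inc (cp_coef r 1%g).
    apply: (@eq_cp_coef _ _ _ X) => g; rewrite cp_coef_in.
    have [->|g1] := eqVneq g 1%g; first by rewrite mulr1n.
    rewrite mulr0n; apply: (twisted_scalar0 g1) => a.
    by rewrite -cp_coef_inl -cp_coef_inr hr.
  exists (cp_coef r 1%g); split=> // [|g].
    by apply/centralP => a; apply: (@cp_in_inj _ _ _ X); rewrite !rmorphM -rE hr.
  by apply: cp_act_uniq; rewrite -rE hr.
apply/centralP => t; apply: (@eq_cp_coef _ _ _ X) => g.
by rewrite cp_coef_inl cp_coef_inr zG hz.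
Qed.

End XOuter.

(** * Descent from T to A *)

Lemma ideal_sum (R : nzRingType) (D : set R) (I : Type) (r : seq I) (F : I -> R) :
  left_ideal D -> (forall i, D (F i)) -> D (\sum_(i <- r) F i).
Proof. by case=> D0 DD _ h; apply: big_ind. Qed.

(* Skolem-Noether modulo D: the F i generate the bimodule of the elements that
   realise s as a conjugation. *)
Lemma az_skolem_noether (S : nzRingType) (I : finType) (e : I -> S)
    (f : I -> S -> S) (s : {rmorphism S -> S}) (D : set S) :
  az_basis e f -> ideal D ->
  (forall z a, z \in @central S -> D ((z - s z) * a)) ->
  exists F : I -> S, (forall i a, D (a * F i - F i * s a)) /\
                     D (\sum_i F i * s (e i) - 1).
Proof.
move=> ef [idl idr] Dz; have [D0 DD Dl] := idl.
have [/choice[w hw] fc fe] := ef.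
have badd : biadditive (fun u v => u * s v).
  by split=> u v t; rewrite ?rmorphD ?mulrDl ?mulrDr.
have bal u v z : z \in @central S -> D (u * s (z * v) - u * z * s v).
  move=> hz; rewrite rmorphM -mulrA -mulrBr -mulrBl -opprB mulNr mulrN.
  by apply: ideal_opp => //; apply/Dl/Dz.
have inj := @az_balanced S S _ D badd D0 DD I e f ef bal.
exists (fun i => \sum_(p <- w i) p.1 * s p.2); split=> [i a|].
  (* This list encodes the relation a f_i(x) - f_i(x) a = 0. *)
  have := inj ([seq (a * p.1, p.2) | p <- w i]
    ++ [seq (- p.1, p.2) | p <- [seq (p.1, p.2 * a) | p <- w i]]).
  rewrite big_cat !big_map /= => h.
  rewrite (_ : _ - _ = \sum_(p <- w i) a * p.1 * s p.2
                     + \sum_(p <- w i) - p.1 * s (p.2 * a)).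
    apply: h => x; rewrite sw_cat sw_opp sw_mull sw_mulr -hw.
    by rewrite (centralP _ (fc i x)) subrr.
  rewrite mulr_sumr mulr_suml -sumrN.
  by congr (_ + _); apply: eq_bigr => p _; rewrite ?mulNr ?rmorphM !mulrA.
(* This list encodes the relation sum_i f_i(x) e_i - x = 0. *)
have := inj (flatten [seq [seq (p.1, p.2 * e i) | p <- w i] | i <- enum I]
               ++ [:: (-1, 1)]).
rewrite big_cat big_seq1 big_flatten big_map /= rmorph1 mulr1 => h.
rewrite (_ : \sum_i _ = \sum_(i <- enum I)
    \sum_(p <- [seq (p.1, p.2 * e i) | p <- w i]) p.1 * s p.2).
  apply: h => x; rewrite sw_cat sw_flatten {2}/sw big_seq1 /= mulr1 mulN1r.
  rewrite [in X in _ + X](fe x) -sumrN big_enum /= -big_split big1 // => i _ /=.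
  rewrite /sw big_map /= hw /sw mulr_suml -sumrN -big_split big1 // => p _ /=.
  by rewrite mulrA subrr.
rewrite big_enum; apply: eq_bigr => i _; rewrite big_map mulr_suml.
by apply: eq_bigr => p _; rewrite rmorphM mulrA.
Qed.

Section FromCrossed.
Variables (A : nzRingType) (G : finGroupType) (T : nzRingType).
Variable X : crossed_product A G T.
Variables (Q : nzRingType) (j : {rmorphism A -> Q}).
Hypotheses (A_prime : prime_ring A) (Q_mart : symmetric_martindale j).
Hypothesis X_out : x_outer X j.
Local Notation inc := (cp_in X).
Local Notation bar := (cp_bar X).
Local Notation act := (cp_act X).
Local Notation coef := (cp_coef X).
Local Notation centralT := (central_crossedP A_prime Q_mart X_out _).
Local Notation scalar0 := (twisted_scalar0 A_prime Q_mart X_out).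

(** If g fixed the centre, Skolem-Noether with [D] = {0} would give elements F_i with a F_i = F_i
    g(a). X-outerness makes them zero, against sum_i F_i g(e_i) = 1. *)
Lemma az_act_faithful (I : finType) (e : I -> A) (f : I -> A -> A) g :
  az_basis e f -> g != 1%g -> exists2 z, z \in @central A & act g z != z.
Proof.
move=> ef g1; apply: contrapT => nz.
have fix_z z : z \in @central A -> act g z = z.
  by move=> hz; apply/eqP/negPn/negP => gz; apply: nz; exists z.
have idD : ideal [set 0 : A].
  by split; split=> // [a b -> ->|r a ->]; rewrite ?addr0 ?mulr0 ?mul0r.
have [|F [hF F1]] := @az_skolem_noether A I e f (act g) _ ef idD.
  by move=> z a hz /=; rewrite fix_z // subrr mul0r.
have /eqP := oner_neq0 A; apply.
move: F1 => /eqP; rewrite subr_eq0 => /eqP <-; rewrite big1 // => i _.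
suff -> : F i = 0 by rewrite mul0r.
apply: (scalar0 g1) => a.
by apply/eqP; rewrite -subr_eq0; apply/eqP; apply: hF.
Qed.

Section Basis.
Variables (I : finType) (e : I -> T) (f : I -> T -> T).
Hypothesis ef : az_basis e f.

(** The map (u, v) |-> u_g t v_h is balanced over Z(T), because Z(T) consists of G-invariant
    elements of Z(A). *)
Lemma az_coef g h t (s : seq (T * T)) : (forall x, sw s x = 0) ->
  \sum_(p <- s) inc (coef p.1 g) * t * inc (coef p.2 h) = 0.
Proof.
apply: (@az_balanced0 T _ (fun u v => inc (coef u g) * t * inc (coef v h)) _ _ _ ef).
  by split=> u v w; rewrite cp_coefD rmorphD ?mulrDl ?mulrDr.
move=> u v r hr; have [z [_ rz zG]] := centralT hr.
rewrite rz cp_coef_inl cp_coef_inr zG !rmorphM -rz -!mulrA; congr (_ * _).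
by rewrite !mulrA (centralP _ hr).
Qed.

Lemma az_coefA g h a (s : seq (T * T)) : (forall x, sw s x = 0) ->
  \sum_(p <- s) coef p.1 g * a * coef p.2 h = 0.
Proof.
move=> /(az_coef g h (inc a)) hs; apply: (@cp_in_inj _ _ _ X).
rewrite rmorph_sum rmorph0 -[RHS]hs; apply: eq_bigr => p _.
by rewrite !rmorphM.
Qed.

(** [psi i h] keeps from the sandwich f_i the left coefficients at 1 and the right ones at h.
    Centrality of f_i becomes a psi = psi h(a): central values for h = 1, zero otherwise. *)
Lemma crossed_az_basis :
  exists f' : I -> A -> A, az_basis (fun i => coef (e i) 1%g) f'.
Proof.
have [/choice[w hw] fc fe] := ef.
pose psi i h x := \sum_(p <- w i) coef p.1 1%g * x * coef p.2 h.
have psiC i h x a : a * psi i h x = psi i h x * act h a.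
  have := @az_coefA 1%g h x
    ([seq (inc a * p.1, p.2) | p <- w i]
     ++ [seq (- p.1, p.2) | p <- [seq (p.1, p.2 * inc a) | p <- w i]]).
  rewrite big_cat !big_map /= => H; apply/eqP; rewrite -subr_eq0; apply/eqP.
  rewrite -[RHS]H => [|y]; last first.
    by rewrite sw_cat sw_opp sw_mull sw_mulr -hw (centralP _ (fc i y)) subrr.
  rewrite mulr_sumr mulr_suml -sumrN; congr (_ + _); apply: eq_bigr => p _.
    by rewrite cp_coef_inl !mulrA.
  by rewrite cp_coef_inr cp_coefN !mulNr !mulrA.
exists (fun i => psi i 1%g); split=> [i|i x|x].
- exists [seq (coef p.1 1%g, coef p.2 1%g) | p <- w i] => x.
  by rewrite /sw big_map.
- by apply/centralP => a; rewrite psiC cp_act1.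
(* The relation sum_i f_i(y) e_i - y = 0 is read at the coefficients (1, 1). *)
have := @az_coefA 1%g 1%g x
  (flatten [seq [seq (p.1, p.2 * e i) | p <- w i] | i <- enum I] ++ [:: (-1, 1)]).
rewrite big_cat big_seq1 big_flatten big_map /= big_enum /= => H.
apply/eqP; rewrite eq_sym -subr_eq0; apply/eqP.
rewrite -[RHS]H => [|y]; last first.
  rewrite sw_cat sw_flatten {2}/sw big_seq1 /= mulr1 mulN1r.
  rewrite [in X in _ + X](fe y) -sumrN big_enum /= -big_split big1 // => i _ /=.
  rewrite /sw big_map /= hw /sw mulr_suml -sumrN -big_split big1 // => p _ /=.
  by rewrite mulrA subrr.
congr (_ + _); last first.
  rewrite cp_coefN -(rmorph1 inc) !cp_coef_in eqxx.
  by rewrite mulr1 mulN1r.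
apply: eq_bigr => i _; rewrite big_map /=.
under [RHS]eq_bigr => p _ do rewrite cp_coef_mul1 mulr_sumr.
rewrite exchange_big (bigD1 1%g) //= [X in _ + X]big1 ?addr0 => [|h h1].
  rewrite invg1 cp_cocycle11 mulr_suml; apply: eq_bigr => p _.
  by rewrite mulr1 cp_act1 mulrA.
transitivity (psi i h x * (act h (coef (e i) h^-1%g) * cp_cocycle X h h^-1%g)).
  by rewrite mulr_suml; apply: eq_bigr => p _; rewrite !mulrA.
suff -> : psi i h x = 0 by rewrite mul0r.
by apply: (scalar0 h1) => a; rewrite psiC.
Qed.

(** The projection is Z(T)-linear, hence a sandwich over [T]. As it commutes with multiplication by
    Z(A) on both sides and [G] is faithful on Z(A), only its part [Psi 1 1], with coefficients in
    [A], is nonzero. *)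
Lemma crossed_projection_sw : azumaya T -> exists s : seq (A * A),
  forall t, inc (coef t 1%g) = \sum_(p <- s) inc p.1 * t * inc p.2.
Proof.
move=> azT.
have [w hw] : is_sw (fun t => inc (coef t 1%g)).
  apply: azumaya_is_sw => // _ x y /centralT[z [_ -> _]].
  by rewrite cp_coefD cp_coef_inl rmorphD rmorphM.
pose Psi g h t := \sum_(p <- w) inc (coef p.1 g) * t * inc (coef p.2 h).
have [f' ef'] := crossed_az_basis.
have regl z t : z \in @central A -> z != 0 -> inc z * t = 0 -> t = 0.
  move=> hz z0 zt; apply: (@eq_cp_coef _ _ _ X) => k; rewrite cp_coef0.
  apply: (prime_central_regular A_prime hz z0).
  by rewrite -cp_coef_inl zt cp_coef0.
(* The projection sends zy to z times the projection of y; at g this says that z - g(z) kills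
   [Psi g h], and it is a regular element for a suitable z. *)
have Psil g h t : g != 1%g -> Psi g h t = 0.
  move=> g1; have [z hz zg] := az_act_faithful ef' g1.
  apply: (@regl (z - act g z)); rewrite ?rpredB ?cp_act_centralE //.
    by rewrite subr_eq0 eq_sym.
  have := @az_coef g h t
    ([seq (inc z * p.1, p.2) | p <- w]
     ++ [seq (- p.1, p.2) | p <- [seq (p.1 * inc z, p.2) | p <- w]]).
  rewrite big_cat !big_map /= => H; rewrite -[RHS]H => [|y].
    rewrite rmorphB mulrBl !mulr_sumr -sumrN; congr (_ + _); apply: eq_bigr => p _.
      by rewrite cp_coef_inl rmorphM !mulrA.
    rewrite cp_coefN cp_coef_inr.
    rewrite -((centralP _ (cp_act_centralE X g hz)) (coef p.1 g)).
    by rewrite rmorphN rmorphM !mulNr !mulrA.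
  by rewrite sw_cat sw_opp sw_mull sw_inl -!hw cp_coef_inl rmorphM subrr.
have Psir h t : h != 1%g -> Psi 1%g h t = 0.
  move=> h1; have [z hz zh] := az_act_faithful ef' h1.
  have w0 : act h z - z \in @central A by rewrite rpredB ?cp_act_centralE.
  have H0 : Psi 1%g h t * inc (act h z - z) = 0.
    have := @az_coef 1%g h t
      ([seq (p.1, p.2 * inc z) | p <- w]
     ++ [seq (- p.1, p.2) | p <- [seq (p.1, inc z * p.2) | p <- w]]).
    rewrite big_cat !big_map /= => H; rewrite -[RHS]H => [|y].
      rewrite rmorphB mulrBr !mulr_suml -sumrN; congr (_ + _); apply: eq_bigr => p _.
        by rewrite cp_coef_inr rmorphM !mulrA.
      rewrite cp_coefN cp_coef_inl.
      by rewrite ((centralP _ hz) (coef p.2 h)) rmorphN rmorphM !mulNr !mulrA.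
    by rewrite sw_cat sw_opp sw_mulr sw_inr -!hw cp_coef_inr cp_act1 rmorphM subrr.
  (* Here the central factor stands on the right, so at the coefficient k it appears as its image
     under [act k]. *)
  apply: (@eq_cp_coef _ _ _ X) => k; rewrite cp_coef0.
  have kc := cp_act_centralE X k w0.
  apply: (prime_central_regular A_prime kc).
    by rewrite -(rmorph0 (act k)) (inj_eq (@cp_act_inj _ _ _ X k)) subr_eq0.
  by rewrite (centralP _ kc) -cp_coef_inr H0 cp_coef0.
exists [seq (coef p.1 1%g, coef p.2 1%g) | p <- w] => t; rewrite big_map /=.
rewrite hw -/(Psi 1%g 1%g t).
transitivity (\sum_g \sum_h Psi g h (bar g * t) * bar h).
  under eq_bigr => g _ do under eq_bigr => h _ do rewrite mulr_suml.
  under eq_bigr => g _ do rewrite exchange_big.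
  rewrite exchange_big; apply: eq_bigr => p _ /=.
  rewrite [p.1 in LHS](cp_coefE X) [p.2 in LHS](cp_coefE X) !mulr_suml.
  apply: eq_bigr => g _; rewrite mulr_sumr; apply: eq_bigr => h _.
  by rewrite !mulrA.
rewrite (bigD1 1%g) //= [X in _ + X]big1 => [|g g1]; last first.
  by rewrite big1 // => h _; rewrite Psil // mul0r.
rewrite addr0 (bigD1 1%g) //= big1 => [|h h1]; last by rewrite Psir // mul0r.
by rewrite !cp_bar1 mul1r mulr1 addr0.
Qed.

End Basis.

(** [D] is mA. Skolem-Noether modulo [D] gives F_i with a F_i = F_i g(a) and sum_i F_i g(e_i) = 1
    modulo [D]; the sandwich [s] forces F_i into [D], so [D] contains 1. *)
Lemma crossed_coordinates_ideal (I : finType) (e : I -> A) (f : I -> A -> A)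
    (ef : az_basis e f) (s : seq (A * A)) g (m : set (centre A)) :
  (forall t, inc (coef t 1%g) = \sum_(p <- s) inc p.1 * t * inc p.2) ->
  g != 1%g -> ideal m -> (forall z, m (z - cp_act_centre X g z)) ->
  forall i x, m (az_coord ef i x).
Proof.
move=> hs g1 [idl idr] mg; have [m0 mD ml] := idl.
pose D : set A := fun x => forall i, m (az_coord ef i x).
have idD : ideal D.
  split; split=> [i|x y Dx Dy i|r x Dx i]; rewrite ?az_coord0 ?az_coordD //;
    try exact: mD.
    rewrite (az_coord_basis ef x) mulr_sumr az_coord_sum; apply: ideal_sum => // k.
    by rewrite centre_scaleE mulrA -centreC -mulrA az_coordZ mulrC; apply: ml.
  rewrite (az_coord_basis ef x) mulr_suml az_coord_sum; apply: ideal_sum => // k.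
  by rewrite centre_scaleE -mulrA az_coordZ mulrC; apply: ml.
have [Dl Dr] := idD; have [D0 DD Dll] := Dl; have [_ _ Drr] := Dr.
have [|F [hF F1]] := @az_skolem_noether A I e f (act g) D ef idD.
  move=> z a hz i.
  have -> : (z - act g z) * a
      = centre_val (Centre hz - cp_act_centre X g (Centre hz)) * a by [].
  by rewrite az_coordZ mulrC; apply/ml/mg.
have s1 : \sum_(p <- s) p.1 * p.2 = 1.
  apply: (@cp_in_inj _ _ _ X); rewrite rmorph_sum rmorph1.
  have := hs 1; rewrite -[in coef _ _](rmorph1 inc) cp_coef_in eqxx rmorph1 => ->.
  by apply: eq_bigr => p _; rewrite mulr1 rmorphM.
(* The projection is evaluated at x [bar g], whose coefficient at 1 is zero; above it was evaluated
   at 1. *)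
have sg x : \sum_(p <- s) p.1 * x * act g p.2 = 0.
  apply: (@cp_in_inj _ _ _ X); rewrite rmorph_sum rmorph0.
  apply: (@cp_mulI _ _ _ X g); rewrite mul0r mulr_suml.
  have := hs (inc x * bar g); rewrite cp_coef_bar eq_sym (negPf g1) mulr0n rmorph0 => H.
  rewrite [RHS]H.
  by apply: eq_bigr => p _; rewrite !rmorphM -!mulrA (cp_actE X).
have DF i : D (F i).
  have -> : F i = \sum_(p <- s) p.1 * (p.2 * F i - F i * act g p.2).
    transitivity (\sum_(p <- s) p.1 * p.2 * F i - \sum_(p <- s) p.1 * F i * act g p.2).
      by rewrite sg subr0 -mulr_suml s1 mul1r.
    by rewrite -sumrB; apply: eq_bigr => p _; rewrite mulrBr !mulrA.
  by apply: ideal_sum => // p; apply: Dll.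
have D1 : D 1.
  have := DD _ _ (ideal_sum (index_enum I) Dl (fun i => Drr (act g (e i)) _ (DF i)))
                (ideal_opp Dl F1).
  by rewrite opprB addrC subrK.
by move=> i x; rewrite -[x]mulr1; apply: (Dll x 1 D1).
Qed.

End FromCrossed.

(** * Rank and trace *)

Lemma field_from (R : comNzRingType) : (forall x : R, x != 0 -> exists y, y * x = 1) ->
  exists (F : fieldType) (phi : {rmorphism R -> F}), bijective phi.
Proof.
move=> hR.
have /choice[h hP] : forall x : R, exists y, x != 0 -> y * x = 1.
  by move=> x; have [->|/hR[y]] := eqVneq x 0; [exists 0|exists y].
pose inv (x : R) := if x == 0 then 0 else h x.
have mulVf : forall x, x != 0 -> inv x * x = 1.
  by move=> x x0; rewrite /inv (negPf x0) hP.
have inv0 : inv 0 = 0 by rewrite /inv eqxx.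
pose H := GRing.ComNzRing_isField.Build R mulVf inv0.
pose F : fieldType := HB.pack (GRing.ComNzRing.sort R) (GRing.ComNzRing.class R) H.
by exists F, (idfun : {rmorphism R -> R}); exists id.
Qed.

(** [{fraction D}] requires an integral domain with a chosen inverse; the inverse is picked by
    choice on invertible elements and is the identity elsewhere. *)
Lemma fraction_field_from (R : comNzRingType) :
  (forall x y : R, x != 0 -> x * y = 0 -> y = 0) ->
  exists (F : fieldType) (phi : {rmorphism R -> F}), injective phi.
Proof.
move=> hR.
pose unit := [pred x : R | `[< exists y, y * x = 1 >]].
have /choice[h hP] : forall x : R, exists y, if x \in unit then y * x = 1 else y = x.
  move=> x; case: (boolP (x \in unit)) => [/asboolP[y hy]|_]; first by exists y.
  by exists x.
have mulVx : {in unit, left_inverse 1 h *%R}.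
  by move=> x xu; have := hP x; rewrite xu.
have unitPl : forall x y, y * x = 1 -> unit x by move=> x y yx; apply/asboolP; exists y.
have invr_out : {in [predC unit], h =1 id}.
  by move=> x; rewrite inE /= => /negPf xu; have := hP x; rewrite xu.
pose H := GRing.ComNzRing_hasMulInverse.Build R mulVx unitPl invr_out.
pose U : comUnitRingType := HB.pack (GRing.ComNzRing.sort R) (GRing.ComNzRing.class R) H.
have int : GRing.integral_domain_axiom U.
  move=> x y xy; have [//|x0] := eqVneq x 0.
  by apply/eqP; apply: hR xy.
pose H' := GRing.ComUnitRing_isIntegral.Build U int.
pose D : idomainType := HB.pack (GRing.ComNzRing.sort R) (GRing.ComNzRing.class R) H H'.
exists {fraction D}, (@tofrac D : {rmorphism D -> {fraction D}}).
by move=> x y /eqP; rewrite tofrac_eq => /eqP.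
Qed.

Lemma residue_field_from (Z : comNzRingType) (m : set Z) : maximal_ideal m ->
  exists (F : fieldType) (phi : {rmorphism Z -> F}),
    (forall y, exists x, phi x = y) /\ (forall z, phi z = 0 <-> m z).
Proof.
move=> [[idl idr] m1 mmax]; have [m0 mD ml] := idl.
pose S := [pred z : Z | `[< m z >]].
have Scl : idealr_closed S.
  split; first exact/asboolP.
    by apply/asboolPn.
  move=> a u v /asboolP mu /asboolP mv; apply/asboolP.
  by apply: mD => //; apply: ml.
pose HS := isIdealr.Build Z (S : Z -> bool) Scl.
pose I : idealr Z := HB.pack (S : Z -> bool) HS.
pose pi : {rmorphism Z -> {ideal_quot I}} := \pi_{ideal_quot I}%qT.
have pi0 z : pi z = 0 <-> m z.
  have -> : m z = (z \in I) by rewrite propeqE; split=> [h|/asboolP]; first apply/asboolP.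
  have -> : (z \in I) = (pi z == pi 0) by rewrite -[z in LHS]subr0 Quotient.idealrBE.
  by rewrite rmorph0; split=> /eqP.
have pisurj y : exists x, pi x = y by exists (repr y); rewrite /pi /= reprK.
have [y|F [psi [psi' psiK psi'K]]] := @field_from {ideal_quot I}.
  have [x <-] := pisurj y; move=> x0.
  have nx : ~ m x by move=> /pi0 h; rewrite h eqxx in x0.
  (* [J] is m + xZ; since x is not in m, maximality puts 1 in [J], and the coefficient of x inverts
     it modulo m. *)
  pose J : set Z := fun y => exists2 w, m w & exists c, y = w + c * x.
  have idJl : left_ideal J.
    split=> [|_ _ [w mw [c ->]] [w' mw' [c' ->]]|r _ [w mw [c ->]]].
    - by exists 0 => //; exists 0; rewrite mul0r addr0.
    - by exists (w + w'); [exact: mD|exists (c + c'); rewrite mulrDl addrACA].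
    - by exists (r * w); [exact: ml|exists (r * c); rewrite mulrDr mulrA].
  have idJ : ideal J.
    by split=> //; case: idJl => ? ? Jl; split=> // r a Ja; rewrite mulrC; apply: Jl.
  have [[w mw [c h1]]|nJ1] := pselect (J 1).
    exists (pi c); rewrite -rmorphM -(rmorph1 pi) h1 rmorphD.
    by have /pi0 -> := mw; rewrite add0r.
  case: nx; rewrite -(mmax J idJ nJ1); last first.
    by move=> w mw; exists w => //; exists 0; rewrite mul0r addr0.
  by exists 0 => //; exists 1; rewrite add0r mul1r.
exists F, (psi \o pi); split=> [y|z] /=.
  by have [x hx] := pisurj (psi' y); exists x; rewrite hx psi'K.
rewrite -pi0; split=> [|->]; last by rewrite rmorph0.
by rewrite -(rmorph0 psi) => /(can_inj psiK).
Qed.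

Lemma natr_inj_pchar0 (F : fieldType) (d r : nat) :
  [pchar F] =i pred0 -> d%:R = r%:R :> F -> d = r.
Proof.
move=> /pcharf0P ch0; wlog dr : d r / (d <= r)%N => [hw|].
  by case/orP: (leq_total d r) => dr /esym h; [apply: hw|apply/esym/hw].
move=> /esym/eqP; rewrite -subr_eq0 -natrB // ch0 subn_eq0 => rd.
by apply/eqP; rewrite eqn_leq dr.
Qed.

(** In the rank factorisation P = C B, cancelling in PP = P gives B C = 1, and tr(C B) = tr(B C). *)
Lemma mxtrace_idempotent (F : fieldType) (n : nat) (P : 'M[F]_n) :
  P *m P = P -> \tr P = (\rank P)%:R.
Proof.
move=> PP; rewrite -[in LHS](mulmx_base P) mxtrace_mulC.
suff -> : row_base P *m col_base P = 1%:M by rewrite mxtrace1.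
apply: (row_free_inj (row_base_free P)); apply: (row_full_inj (col_base_full P)).
by rewrite mul1mx -(mulmxA (row_base P)) mulmx_base (mulmxA (col_base P)) mulmx_base PP.
Qed.

Lemma centre_val_sum (S : nzRingType) (I : Type) (r : seq I) (F : I -> centre S) :
  centre_val (\sum_(i <- r) F i) = \sum_(i <- r) centre_val (F i).
Proof. by apply: (big_morph (@centre_val S)). Qed.

Lemma centre_val_nat (S : nzRingType) n : centre_val (n%:R : centre S) = n%:R.
Proof. by elim: n => // n IH; rewrite -!natr1 -IH. Qed.

(** * Ranks as traces of dual bases *)

Section Rank.
Variables (S : nzRingType) (n : nat) (e : 'I_n -> S) (f : 'I_n -> S -> S).
Hypothesis ef : az_basis e f.
Local Notation Z := (centre S).
Local Notation SZ := (over_centre S).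

Section Fibre.
Variables (F : fieldType) (phi : {rmorphism Z -> F}).

(** The idempotent of the splitting given by the dual basis, specialised along [phi]; at a residue
    field its row space models the fibre. *)
Definition coord_mx : 'M[F]_n := \matrix_(i, j) phi (az_coord ef j (e i)).
Definition coord_row (x : SZ) : 'rV[F]_n := \row_j phi (az_coord ef j x).

Lemma coord_row_sum (m : nat) (c : 'I_m -> Z) (g : 'I_m -> SZ) :
  coord_row (\sum_i c i *: g i) = \sum_i phi (c i) *: coord_row (g i).
Proof.
apply/rowP => j; rewrite mxE az_coord_sum rmorph_sum summxE.
by apply: eq_bigr => i _; rewrite !mxE centre_scaleE az_coordZ rmorphM.
Qed.

Lemma coord_rowE x : coord_row x = coord_row x *m coord_mx.
Proof.
rewrite {1}(az_coord_basis ef x) coord_row_sum.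
apply/rowP => j; rewrite summxE mxE; apply: eq_bigr => i _.
by rewrite !mxE.
Qed.

Lemma coord_mx_idem : coord_mx *m coord_mx = coord_mx.
Proof.
apply/row_matrixP => i; rewrite row_mul.
have -> : row i coord_mx = coord_row (e i) by apply/rowP => j; rewrite !mxE.
by rewrite -coord_rowE.
Qed.

Lemma coord_mx_trace : \tr coord_mx = phi (\sum_i az_coord ef i (e i)).
Proof. by rewrite rmorph_sum; apply: eq_bigr => i _; rewrite mxE. Qed.

(** [coord_row] has kernel mS and image the row space of [coord_mx]; lifts of [row_base] give the
    basis. *)
Lemma az_fibre_dim (m : set Z) :
  (forall y, exists x, phi x = y) -> (forall z, phi z = 0 <-> m z) ->
  @fibre_dim Z SZ m (\rank coord_mx).
Proof.
move=> surj ker.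
have sub0 x : ideal_submod m x <-> coord_row x = 0.
  split=> [[k [z [a [mz ->]]]]|x0].
    by rewrite coord_row_sum big1 // => i _; rewrite (iffRL (ker _)) ?scale0r.
  exists n, (fun i => az_coord ef i x), (e : 'I_n -> SZ); split=> [i|].
    by apply/ker; move/rowP/(_ i): x0; rewrite !mxE.
  exact: az_coord_basis.
have /choice[lft lftP] := surj.
have row_lift (u : 'rV[F]_n) : exists x, coord_row x = u *m coord_mx.
  exists (\sum_i lft (u 0 i) *: (e i : SZ)); rewrite coord_row_sum.
  apply/rowP => j; rewrite summxE mxE; apply: eq_bigr => i _.
  by rewrite !mxE lftP.
have hb l : exists x, coord_row x = row l (row_base coord_mx).
  have /submxP[u ->] : (row l (row_base coord_mx) <= coord_mx)%MS.
    by rewrite (submx_trans (row_sub _ _)) // eq_row_base.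
  exact: row_lift.
have [E hE] := choice hb.
have sumE (c : 'I_(\rank coord_mx) -> Z) :
    coord_row (\sum_l c l *: E l) = (\row_l phi (c l)) *m row_base coord_mx.
  rewrite coord_row_sum mulmx_sum_row; apply: eq_bigr => l _.
  by rewrite hE mxE.
exists E; split=> [x|c /sub0].
  have /submxP[u hu] : (coord_row x <= row_base coord_mx)%MS.
    by rewrite eq_row_base coord_rowE submxMl.
  exists (fun l => lft (u 0 l)); apply/sub0.
  have -> : x - \sum_l lft (u 0 l) *: E l = x + \sum_l (- lft (u 0 l)) *: E l.
    by rewrite -sumrN; congr (_ + _); apply: eq_bigr => l _; rewrite scaleNr.
  have cD y : coord_row (x + y) = coord_row x + coord_row y.
    by apply/rowP => i; rewrite !mxE az_coordD rmorphD.
  rewrite cD sumE hu -mulmxDl.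
  rewrite (_ : _ + _ = 0) ?mul0mx //.
  by apply/rowP => l; rewrite !mxE rmorphN lftP subrr.
rewrite sumE => /(canRL (mulmxKp (row_base_free _))); rewrite mul0mx => /rowP h l.
by apply/ker; have := h l; rewrite !mxE.
Qed.

End Fibre.

(** Over the fraction field of the centre the trace is the rank of an idempotent. Rank zero would
    make all coordinates of 1 vanish. *)
Lemma az_trace_natr :
  (forall x y : Z, x != 0 -> x * y = 0 -> y = 0) ->
  (forall d, (0 < d)%N -> d%:R != 0 :> S) ->
  exists2 r, (0 < r)%N & \sum_i f i (e i) = r%:R.
Proof.
move=> dom ch0; have [F [phi phiI]] := fraction_field_from dom.
exists (\rank (coord_mx phi)).
  rewrite lt0n mxrank_eq0; apply: contraTneq (oner_neq0 S) => P0.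
  rewrite negbK; rewrite {1}[1](az_coord_basis ef) big1 // => i _.
  suff -> : az_coord ef i 1 = 0 by rewrite scale0r.
  have := coord_rowE phi 1; rewrite P0 mulmx0 => /rowP/(_ i); rewrite !mxE.
  by rewrite -(rmorph0 phi) => /phiI.
have h : \sum_i az_coord ef i (e i) = (\rank (coord_mx phi))%:R.
  apply: phiI; rewrite -coord_mx_trace (mxtrace_idempotent (coord_mx_idem phi)).
  by rewrite rmorph_nat.
transitivity (centre_val (\sum_i az_coord ef i (e i))).
  rewrite centre_val_sum.
  by apply: eq_bigr => i _; rewrite /= az_coordE.
by rewrite h centre_val_nat.
Qed.

Lemma natr_unit_central d : is_unit (d%:R : S) -> exists w : Z, w * d%:R = 1.
Proof.
move=> [v [vd dv]].
have dC a : a * d%:R = d%:R * a by rewrite mulr_natl mulr_natr.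
have hv : v \in @central S.
  apply/centralP => a; rewrite -[LHS]mulr1 -dv mulrA -[v * a * _]mulrA dC.
  by rewrite mulrA vd mul1r.
exists (Centre hv); apply: val_inj.
by transitivity (v * d%:R); [rewrite -[in RHS]centre_val_nat|exact: vd].
Qed.

(** Positive integers are units, so residue fields have characteristic 0 and the trace determines
    the rank of the idempotent as an integer. *)
Lemma az_has_rank r : \sum_i f i (e i) = r%:R ->
  (forall d, (0 < d)%N -> is_unit (d%:R : S)) -> has_rank S r.
Proof.
move=> tr_r units m mmax.
have [F [phi [surj ker]]] := residue_field_from mmax.
have ch0 : [pchar F] =i pred0.
  move=> p; apply/negP => /andP[pp /eqP p0].
  have [w wp] := natr_unit_central (units _ (prime_gt0 pp)).
  have /eqP := oner_neq0 F; apply.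
  by rewrite -(rmorph1 phi) -wp rmorphM rmorph_nat p0 mulr0.
suff -> : r = \rank (coord_mx phi) by apply: az_fibre_dim.
have h : \sum_i az_coord ef i (e i) = r%:R.
  apply: val_inj; rewrite /= centre_val_sum centre_val_nat -tr_r.
  by apply: eq_bigr => i _; rewrite /= az_coordE.
have := mxtrace_idempotent (coord_mx_idem phi).
rewrite coord_mx_trace h rmorph_nat.
exact: natr_inj_pchar0.
Qed.

End Rank.

(** * Galois coordinates and the Azumaya property of T *)

Lemma maximal_ideal_above (R : nzRingType) (I : set R) : ideal I -> ~ I 1 ->
  exists2 m, maximal_ideal m & (I `<=` m)%classic.
Proof.
move=> idI I1.
pose P (J : set R) := J = set0%classic \/ [/\ ideal J, ~ J 1 & (I `<=` J)%classic].
have [F FP tot|m [Pm mmax]] := @Zorn_bigcup _ P.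
  have [[J0 [FJ0 [x J0x]]]|none] := pselect (exists J, F J /\ exists x, J x); last first.
    left; apply/seteqP; split=> // x [J FJ Jx]; apply: none.
    by exists J; split=> //; exists x.
  have FJ J y : F J -> J y -> [/\ ideal J, ~ J 1 & (I `<=` J)%classic].
    by move=> /FP[->|].
  have [[[J00 _ _] _] J01 IJ0] := FJ J0 x FJ0 J0x.
  have add a b : (\bigcup_(J in F) J)%classic a -> (\bigcup_(J in F) J)%classic b ->
      (\bigcup_(J in F) J)%classic (a + b).
    move=> [J FJa Ja] [K FKb Kb].
    have [[[_ JD _] _] _ _] := FJ J a FJa Ja.
    have [[[_ KD _] _] _ _] := FJ K b FKb Kb.
    have [JK|KJ] := tot J K FJa FKb; [exists K|exists J] => //.
      by apply: KD => //; apply: JK.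
    by apply: JD => //; apply: KJ.
  right; split; [split; split=> //|..].
  - by exists J0.
  - move=> r a [J FJa Ja]; exists J => //.
    by have [[[_ _ Jl] _] _ _] := FJ J a FJa Ja; apply: Jl.
  - by exists J0.
  - move=> r a [J FJa Ja]; exists J => //.
    by have [[_ [_ _ Jr]] _ _] := FJ J a FJa Ja; apply: Jr.
  - by move=> [J FJ1 J1]; have [_ nJ1 _] := FJ J 1 FJ1 J1.
  - by move=> a Ia; exists J0 => //; apply: IJ0.
have I0 : I 0 by case: idI => [[]].
case: Pm => [m0|[idm m1 Im]].
  have mI : (m `<` I)%classic.
    by rewrite m0 properEneq; split=> //; apply/eqP => h; move: I0; rewrite -h.
  by case: (mmax I mI); right; split.
exists m => //; split=> // J idJ J1 mJ; apply/eqP/negPn/negP => /eqP mJn.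
have mpJ : (m `<` J)%classic by rewrite properEneq; split=> //; apply/eqP => /esym.
by apply: (mmax J mpJ); right; split=> // a /Im/mJ.
Qed.

(** The trace is a sum of coordinates, so it lies in [m], and it is the unit [r]. *)
Lemma az_coord_unit_ideal (S : nzRingType) (I : finType) (e : I -> S)
    (f : I -> S -> S) (ef : az_basis e f) (m : set (centre S)) r :
  left_ideal m -> (forall i x, m (az_coord ef i x)) ->
  \sum_i f i (e i) = r%:R -> is_unit (r%:R : S) -> m 1.
Proof.
move=> idm mc tr_r /natr_unit_central[w <-]; have [_ _ ml] := idm; apply: ml.
have <- : \sum_i az_coord ef i (e i) = r%:R.
  apply: val_inj; rewrite /= centre_val_sum centre_val_nat -tr_r.
  by apply: eq_bigr => i _; rewrite az_coordE.
by apply: ideal_sum.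
Qed.

Lemma az_basis_reindex (S : nzRingType) (I : finType) (e : I -> S) (f : I -> S -> S) :
  az_basis e f ->
  az_basis (fun i : 'I_#|I| => e (enum_val i)) (fun i => f (enum_val i)).
Proof.
move=> [fsw fc fe]; split=> // x.
by rewrite {1}[x]fe (reindex _ (onW_bij _ (@enum_val_bij I))).
Qed.

Section Galois.
Variables (A : nzRingType) (G : finGroupType) (T : nzRingType).
Variable X : crossed_product A G T.
Local Notation inc := (cp_in X).
Local Notation bar := (cp_bar X).
Local Notation act := (cp_act X).
Local Notation coef := (cp_coef X).
Local Notation Z := (centre A).
Local Notation ga := (cp_act_centre X).

Fact cp_act_centre_zmod g : zmod_morphism (ga g).
Proof. by move=> a b; apply: val_inj; rewrite /= -rmorphB. Qed.

Fact cp_act_centre_monoid g : monoid_morphism (ga g).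
Proof.
split=> [|a b]; apply: val_inj; rewrite /=; first exact: (rmorph1 (act g)).
exact: (rmorphM (act g)).
Qed.

HB.instance Definition _ g :=
  GRing.isZmodMorphism.Build Z Z (ga g) (cp_act_centre_zmod g).
HB.instance Definition _ g :=
  GRing.isMonoidMorphism.Build Z Z (ga g) (cp_act_centre_monoid g).

Lemma cp_act_centre1 z : ga 1%g z = z.
Proof. by apply: val_inj; rewrite /= cp_act1. Qed.

Lemma cp_act_centreM g h z : ga (g * h)%g z = ga g (ga h z).
Proof. by apply: val_inj; rewrite /= cp_actM_central //; case: z. Qed.

Lemma cp_act_centreK g z : ga g (ga g^-1%g z) = z.
Proof. by rewrite -cp_act_centreM mulgV cp_act_centre1. Qed.

Definition augmentation (g : G) : set Z := fun z =>
  exists s : seq (Z * Z), z = \sum_(p <- s) p.1 * (p.2 - ga g p.2).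

Lemma augmentation_ideal g : ideal (augmentation g).
Proof.
have l : left_ideal (augmentation g).
  split=> [|_ _ [s ->] [t ->]|r _ [s ->]].
  - by exists [::]; rewrite big_nil.
  - by exists (s ++ t); rewrite big_cat.
  - exists [seq (r * p.1, p.2) | p <- s]; rewrite big_map mulr_sumr.
    by apply: eq_bigr => p _; rewrite mulrA.
by split=> //; case: l => ? ? ml; split=> // r a; rewrite mulrC; apply: ml.
Qed.

Lemma augmentation_gen g z : augmentation g (z - ga g z).
Proof. by exists [:: (1, z)]; rewrite big_seq1 mul1r. Qed.

(** For each g <> 1 a list is built with sum p q = 1 and sum p g(q) = 0. Products of lists multiply
    such sums for every h, so the product over all g has all the zeros required. *)
Lemma galois_coordinates : (forall g, g != 1%g -> augmentation g 1) ->
  exists s : seq (Z * Z), forall h, \sum_(p <- s) p.1 * ga h p.2 = (h == 1%g)%:R.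
Proof.
move=> aug.
suff [s [s1 sh]] : exists s : seq (Z * Z), \sum_(p <- s) p.1 * p.2 = 1 /\
    forall h, h \in enum [set~ 1%g : G] -> \sum_(p <- s) p.1 * ga h p.2 = 0.
  exists s => h; have [->|h1] := eqVneq h 1%g.
    by rewrite -s1; apply: eq_bigr => p _; rewrite cp_act_centre1.
  by rewrite sh // mem_enum !inE.
have : forall h, h \in enum [set~ 1%g : G] -> h != 1%g.
  by move=> h; rewrite mem_enum !inE.
elim: (enum _) => [|g l IH] hl.
  by exists [:: (1, 1)]; rewrite big_seq1 mulr1.
have [|s [s1 sh]] := IH; first by move=> h hh; apply: hl; rewrite inE hh orbT.
have [t ht] := aug g (hl g (mem_head _ _)).
(* From 1 = sum x (y - g(y)), the extra pair (- sum x g(y), 1) cancels the sum twisted by g and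
   leaves 1 for the untwisted one. *)
pose u := rcons t (- \sum_(p <- t) p.1 * ga g p.2, 1).
have u1 : \sum_(p <- u) p.1 * p.2 = 1.
  rewrite big_rcons /= mulr1 ht -sumrN -big_split.
  by apply: eq_bigr => p _ /=; rewrite mulrBr.
have ug : \sum_(p <- u) p.1 * ga g p.2 = 0.
  by rewrite big_rcons /= rmorph1 mulr1 subrr.
have prod h : \sum_(p <- [seq (p.1 * q.1, p.2 * q.2) | p <- s, q <- u]) p.1 * ga h p.2
    = (\sum_(p <- s) p.1 * ga h p.2) * (\sum_(p <- u) p.1 * ga h p.2).
  rewrite big_allpairs_dep mulr_suml; apply: eq_bigr => p _.
  rewrite mulr_sumr; apply: eq_bigr => q _ /=.
  by rewrite rmorphM mulrACA.
exists [seq (p.1 * q.1, p.2 * q.2) | p <- s, q <- u]; split=> [|h].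
  transitivity ((\sum_(p <- s) p.1 * p.2) * (\sum_(p <- u) p.1 * p.2)).
    rewrite big_allpairs_dep mulr_suml; apply: eq_bigr => p _.
    rewrite mulr_sumr; apply: eq_bigr => q _ /=.
    by rewrite mulrACA.
  by rewrite s1 u1 mulr1.
rewrite inE prod => /orP[/eqP->|/sh->]; last by rewrite mul0r.
by rewrite ug mulr0.
Qed.

Section Basis.
Variables (I : finType) (e : I -> A) (f : I -> A -> A).
Hypothesis ef : az_basis e f.
Variable s : seq (Z * Z).
Hypothesis sG : forall h, \sum_(p <- s) p.1 * ga h p.2 = (h == 1%g)%:R.
Variables (Q : nzRingType) (j : {rmorphism A -> Q}).
Hypotheses (A_prime : prime_ring A) (Q_mart : symmetric_martindale j).
Hypothesis X_out : x_outer X j.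

Let p (k : 'I_(size s)) : A := (tnth (in_tuple s) k).1.
Let q (k : 'I_(size s)) : A := (tnth (in_tuple s) k).2.

Definition tr (a : A) : A := \sum_(h : G) act h a.

Lemma galois_sum h : \sum_k p k * act h (q k) = (h == 1%g)%:R.
Proof.
have := congr1 (@centre_val A) (sG h); rewrite centre_val_nat => <-.
by rewrite centre_val_sum [in RHS](big_tnth _ _ s).
Qed.

Let pc k : p k \in @central A. Proof. by rewrite /p; case: (_.1). Qed.
Let qc k : q k \in @central A. Proof. by rewrite /q; case: (_.2). Qed.

(** Expanding the trace, h(z) is multiplied by h(sum_k p_k h^-1(q_k)), which is 1 for h = 1 and 0
    otherwise. *)
Lemma tr_expand z : z \in @central A -> z = \sum_k tr (p k * z) * q k.
Proof.
move=> hz; under eq_bigr => k _ do rewrite mulr_suml.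
rewrite exchange_big (bigD1 1%g) //= [X in _ + X]big1 ?addr0 => [|h h1].
  transitivity ((\sum_k p k * act 1%g (q k)) * z).
    by rewrite galois_sum eqxx mul1r.
  rewrite mulr_suml; apply: eq_bigr => k _.
  by rewrite !cp_act1 -mulrA (centralP _ (qc k)) mulrA.
transitivity (act h (\sum_k p k * act h^-1%g (q k)) * act h z).
  rewrite rmorph_sum mulr_suml; apply: eq_bigr => k _.
  rewrite !rmorphM /= -cp_actM_central // mulgV cp_act1 -!mulrA.
  by rewrite (centralP _ (qc k)).
by rewrite galois_sum eq_invg1 (negPf h1) rmorph0 mul0r.
Qed.

Lemma tr_central z : z \in @central A -> inc (tr z) \in @central T.
Proof.
move=> hz; apply/(central_crossedP A_prime Q_mart X_out).
exists (tr z); split=> // [|g].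
  by apply: rpred_sum => h _; apply: cp_act_centralE.
rewrite /tr rmorph_sum [RHS](reindex_inj (mulgI g)).
by apply: eq_bigr => h _; rewrite cp_actM_central.
Qed.

(** The sandwich sum_k p_k t q_k multiplies the coefficient at h by sum_k p_k h(q_k), so it is the
    projection to 1. Other g are moved to 1 by [bar g^-1], up to a cocycle unit. *)
Lemma coef_is_sw g : is_sw (fun t => inc (coef t g)).
Proof.
have p1 : is_sw (fun t => inc (coef t 1%g)).
  apply: (@eq_is_sw _ (fun t => \sum_k inc (p k) * t * inc (q k))) => [t|]; last first.
    by apply: is_sw_sum => k; apply: is_sw_mul.
  apply: (@eq_cp_coef _ _ _ X) => h; rewrite cp_coef_sum cp_coef_in.
  transitivity ((\sum_k p k * act h (q k)) * coef t h).
    rewrite mulr_suml; apply: eq_bigr => k _.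
    rewrite cp_coef_inr cp_coef_inl -!mulrA.
    by rewrite ((centralP _ (cp_act_centralE X h (qc k)))).
  by rewrite galois_sum; case: eqP => [->|_]; rewrite ?mul1r ?mul0r.
have [v [_ gv]] := cp_cocycle_unit X g g^-1%g.
have h := is_sw_scale 1 (inc v) (is_sw_comp p1 (is_sw_mul 1 (bar g^-1%g))).
apply: eq_is_sw h => t /=; rewrite !mul1r.
by rewrite -[X in coef _ X](mulgV g) cp_coef_mulbar -rmorphM -mulrA gv mulr1.
Qed.

(** Three expansions are composed: [T] over [A], [A] over Z(A), and Z(A) over its invariants. *)
Definition cp_basis_elt (x : G * (I * 'I_(size s))) : T :=
  inc (q x.2.2 * e x.2.1) * bar x.1.
Definition cp_basis_form (x : G * (I * 'I_(size s))) (t : T) : T :=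
  inc (tr (p x.2.2 * f x.2.1 (coef t x.1))).

Lemma crossed_product_az_basis : az_basis cp_basis_elt cp_basis_form.
Proof.
have [/choice[w hw] fc fe] := ef; split=> [[g [i k]]|[g [i k]] t|t].
- have [v vP] := choice (cp_bar_unit X).
  have fsw : is_sw (fun t => inc (f i (coef t g))).
    have := is_sw_comp (ex_intro _ [seq (inc x.1, inc x.2) | x <- w i]
      (fun t => erefl)) (coef_is_sw g).
    apply: eq_is_sw => t; rewrite /= hw /sw big_map rmorph_sum.
    by apply: eq_bigr => x _; rewrite !rmorphM.
  (* The trace is itself a sandwich over [T], since [bar h] acts by conjugation as [act h]. *)
  apply: (@eq_is_sw _ (fun t => \sum_h (bar h * inc (p k)) * inc (f i (coef t g)) * v h)).
    move=> t; rewrite /cp_basis_form /tr rmorph_sum; apply: eq_bigr => h _ /=.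
    by rewrite -[bar h * _ * _]mulrA -rmorphM (cp_actE X) -mulrA (vP h).2 mulr1.
  by apply: is_sw_sum => h; apply: is_sw_scale.
- by apply: tr_central; rewrite rpredM.
rewrite [LHS](cp_coefE X).
rewrite -(pair_bigA _ (fun g y => cp_basis_form (g, y) t * cp_basis_elt (g, y))).
apply: eq_bigr => g _ /=.
rewrite -(pair_bigA _
  (fun i k => cp_basis_form (g, (i, k)) t * cp_basis_elt (g, (i, k)))).
rewrite [coef t g in LHS]fe rmorph_sum mulr_suml; apply: eq_bigr => i _ /=.
rewrite {1}[f i _](tr_expand (fc i _)) mulr_suml rmorph_sum mulr_suml.
by apply: eq_bigr => k _; rewrite /cp_basis_form /cp_basis_elt /= mulrA !rmorphM !mulrA.
Qed.

(** As sum_k p_k q_k = 1, each g contributes the trace over [G] of the integer r, which is |G| r. *)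
Lemma cp_basis_trace r : \sum_i f i (e i) = r%:R ->
  \sum_x cp_basis_form x (cp_basis_elt x) = (#|G| ^ 2 * r)%N%:R.
Proof.
move=> tr_r; have [fsw fc fe] := ef.
transitivity (\sum_(g : G) inc (tr (\sum_i \sum_k p k * q k * f i (e i)))).
  rewrite -(pair_bigA _ (fun g y => cp_basis_form (g, y) (cp_basis_elt (g, y)))).
  apply: eq_bigr => g _ /=.
  rewrite -(pair_bigA _ (fun i k =>
    cp_basis_form (g, (i, k)) (cp_basis_elt (g, (i, k))))) /=.
  have trD (K : finType) (F : K -> A) : tr (\sum_i F i) = \sum_i tr (F i).
    by rewrite /tr exchange_big; apply: eq_bigr => h _; rewrite rmorph_sum.
  rewrite trD rmorph_sum; apply: eq_bigr => i _; rewrite trD rmorph_sum.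
  apply: eq_bigr => k _; rewrite /cp_basis_form /cp_basis_elt /=.
  by rewrite cp_coef_bar eqxx mulr1n (is_swZ _ (fsw i)) // mulrA.
have -> : \sum_i \sum_k p k * q k * f i (e i) = r%:R.
  rewrite -tr_r; apply: eq_bigr => i _; rewrite -mulr_suml.
  suff -> : \sum_k p k * q k = 1 by rewrite mul1r.
  transitivity (\sum_k p k * act 1%g (q k)); last by rewrite galois_sum eqxx.
  by apply: eq_bigr => k _; rewrite cp_act1.
rewrite /tr; under [X in inc X]eq_bigr => h _ do rewrite rmorph_nat.
rewrite !sumr_const rmorphMn rmorph_nat -!mulrnA.
by congr (_ *+ _); rewrite -mulnn [RHS]mulnC mulnA.
Qed.

End Basis.
End Galois.

Lemma natr_unit_alg (k : fieldType) (A : algType k) d :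
  [pchar k] =i pred0 -> (0 < d)%N -> is_unit (d%:R : A).
Proof.
move=> /pcharf0P ch0 d0; have dk : d%:R != 0 :> k by rewrite ch0 -lt0n.
exists (d%:R^-1)%:A; split; rewrite -scaler_nat -?scalerAl -?scalerAr ?mul1r ?mulr1;
  by rewrite scalerA ?mulVf ?mulfV // scale1r.
Qed.

Lemma is_unit_neq0 (R : nzRingType) (u : R) : is_unit u -> u != 0.
Proof.
move=> [v [_ uv]]; apply: contraTneq (oner_neq0 R) => u0.
by rewrite negbK -uv u0 mul0r.
Qed.

(** A maximal ideal containing all z - g(z) is stable under g, which puts g in its stabiliser. *)
Lemma free_augmentation (A : nzRingType) (G : finGroupType) (T : nzRingType)
    (X : crossed_product A G T) :
  acts_freely X -> forall g, g != 1%g -> augmentation X g 1.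
Proof.
move=> free g g1; apply: contrapT => aug1.
have [m mmax augm] := maximal_ideal_above (augmentation_ideal X g) aug1.
have [[[m0 mD ml] _] _ _] := mmax.
have mN z : m z -> m (- z) by apply: ideal_opp.
have mB z w : m z -> m w -> m (z - w) by move=> mz mw; apply/mD/mN.
have mg z : m (z - cp_act_centre X g z) by apply/augm/augmentation_gen.
have : stabiliser X m g.
  apply/seteqP; split=> [_ [z mz <-]|z mz].
    by rewrite -(subKr z (cp_act_centre X g z)); apply: mB.
  have zE := cp_act_centreK X g z; exists (cp_act_centre X g^-1%g z) => //.
  by rewrite -[X in m X](subrK z) -{2}zE; apply: mD.
by rewrite (free m mmax) => /eqP; rewrite (negPf g1).
Qed.

Theorem theorem1p1
    (k : closedFieldType) (char0 : [pchar k] =i pred0)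
    (A : algType k) (A_prime : prime_ring A) (A_noeth : noetherian A)
    (G : finGroupType) (T : nzRingType) (X : crossed_product A G T)
    (Q : nzRingType) (j : {rmorphism A -> Q}) (Q_mart : symmetric_martindale j)
    (X_out : x_outer X j) (X_lin : acts_linearly_on_centre X) :
  [/\ prime_ring T,
      noetherian T,
      azumaya A /\ acts_freely X -> azumaya T,
      azumaya T ->
        azumaya A /\ (residue_fields_trivial A -> acts_freely X)
    & azumaya T ->
        exists n, has_rank A n /\ has_rank T (#|G| ^ 2 * n)].
Proof.
have unitA d : (0 < d)%N -> is_unit (d%:R : A) by apply: natr_unit_alg.
have unitT d : (0 < d)%N -> is_unit (d%:R : T).
  move=> /unitA[v [vd dv]]; exists (cp_in X v).
  by rewrite -(rmorph_nat (cp_in X)) -!rmorphM vd dv rmorph1.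
have domZ (x y : centre A) : x != 0 -> x * y = 0 -> y = 0.
  move=> x0 xy; apply: val_inj; apply: (prime_central_regular (z := centre_val x)) => //.
    by case: x {x0 xy}.
  exact: (congr1 (@centre_val A) xy).
have azA_trace (n : nat) (e : 'I_n -> A) f : az_basis e f ->
    exists2 r, (0 < r)%N & \sum_i f i (e i) = r%:R.
  by move=> ef; apply: (az_trace_natr ef domZ) => d d0; apply/is_unit_neq0/unitA.
(* The second clause says that Z(A) is Galois over its invariants; it yields freeness when applied
   to maximal ideals, and Galois coordinates when applied to augmentation ideals. *)
have descent : azumaya T -> exists (n : nat) (e : 'I_n -> A) f,
    az_basis e f /\ forall g (m : set (centre A)), g != 1%g -> ideal m ->
      (forall z, m (z - cp_act_centre X g z)) -> m 1.
  move=> azT; have [n [e [f ef]]] := azumaya_basis azT.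
  have [f' ef'] := crossed_az_basis A_prime Q_mart X_out ef.
  have [s hs] := crossed_projection_sw A_prime Q_mart X_out ef azT.
  exists n, (fun i => cp_coef X (e i) 1%g), f'; split=> // g m g1 idm mg.
  have [r r0 tr_r] := azA_trace _ _ _ ef'.
  have mc := crossed_coordinates_ideal ef' hs g1 idm mg.
  by apply: (az_coord_unit_ideal idm.1 mc tr_r); apply: unitA.
split.
- exact: crossed_product_prime A_prime Q_mart X_out.
- exact: crossed_product_noetherian X A_noeth.
- move=> [/azumaya_basis[n [e [f ef]]] /free_augmentation/galois_coordinates[s sG]].
  exact: az_basis_azumaya (crossed_product_az_basis ef sG A_prime Q_mart X_out).
- move=> /descent[n [e [f [ef mem1]]]]; split; first exact: az_basis_azumaya ef.
  move=> res m mmax; have [idm nm1 _] := mmax; have [[m0 mD ml] _] := idm.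
  apply/seteqP; split=> [g mg|_ ->]; last first.
    apply/seteqP; split=> [_ [z mz <-]|z mz]; first by rewrite cp_act_centre1.
    by exists z => //; rewrite cp_act_centre1.
  apply: contrapT => /eqP g1; apply: nm1; apply: (mem1 g m g1 idm) => z.
  (* Writing z = c + w with c a scalar, which [g] fixes, gives z - g(z) = w - g(w), and both terms
     lie in the g-stable ideal [m]. *)
  have [c [w [mw zE]]] := res m mmax z.
  have -> : z - cp_act_centre X g z = w - cp_act_centre X g w.
    apply: val_inj; rewrite /= zE rmorphD /=.
    have [_ _ lin] := X_lin; have := lin g c 1; rewrite /= => ->.
    by rewrite (rmorph1 (cp_act X g)) opprD addrACA subrr add0r.
  apply: mD => //; apply: (ideal_opp idm.1).
  by rewrite -mg; exists w.
- move=> /descent[n [e [f [ef mem1]]]]; have [r r0 tr_r] := azA_trace _ _ _ ef.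
  have [|s sG] := @galois_coordinates _ _ _ X.
    move=> g g1; apply: (mem1 g) => //; first exact: augmentation_ideal.
    exact: augmentation_gen.
  exists r; split; first exact: az_has_rank ef _ tr_r unitA.
  (* The rank of [T] is read off the trace of this explicit basis, computed from that of [A]. *)
  have EF := crossed_product_az_basis ef sG A_prime Q_mart X_out.
  apply: (az_has_rank (az_basis_reindex EF)) unitT.
  rewrite -(cp_basis_trace ef sG tr_r).
  by rewrite [RHS](reindex _ (onW_bij _ (@enum_val_bij _))).
Qed.
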